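(* Let $p$ be an odd prime, $G=D_{2p}$ the dihedral group of order $2p$, and let $\Theta$ be the $G$-relation $\Theta=1-2C_2-C_p+2D_{2p}$. The Dokchitser constants $\mathcal{C}_\Theta(\Gamma)$ of all the indecomposable $\mathbb{Z}$-free finite rank $\mathbb{Z}[G]$-modules $\Gamma$ are as follows (for all $i$): $\mathcal{C}_\Theta(\mathbf{1})=1/p$; $\mathcal{C}_\Theta(\epsilon)=p$; $\mathcal{C}_\Theta(\Delta)=1$; $\mathcal{C}_\Theta(A_i)=p$; $\mathcal{C}_\Theta(A_i')=1/p$; $\mathcal{C}_\Theta((A_i',\mathbf{1}))=1$; $\mathcal{C}_\Theta((A_i,\epsilon))=1$; $\mathcal{C}_\Theta((A_i,\Delta))=1/p$; $\mathcal{C}_\Theta((A_i',\Delta))=p$; $\mathcal{C}_\Theta((A_i\oplus A_i',\Delta))=1$.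
   Context: Write $G=\langle\sigma,\varpi:\sigma^2=\varpi^p=(\sigma\varpi)^2=1\rangle$, $C_2=\langle\sigma\rangle$, $C_p=\langle\varpi\rangle$. Let $\zeta_p$ be a primitive $p$-th root of unity, $\mathcal{O}=\mathbb{Z}[\zeta_p]$, and let $\{U_i\}$ be ideals representing the ideal class group of the maximal real subfield $\mathbb{Q}(\zeta_p)^+$. The $\mathbb{Z}[G]$-modules are: $\mathbf{1}=\mathbb{Z}$ with trivial action; $\epsilon=\mathbb{Z}$ with $\sigma$ acting by $-1$ and $\varpi$ by $1$; $\Delta=\mathbb{Z}[G/C_p]$; $A_i=U_i\mathcal{O}$ with $\sigma$ acting as complex conjugation and $\varpi$ as multiplication by $\zeta_p$; $A_i'=(\bar\zeta_p-\zeta_p)U_i\mathcal{O}$ with the same action. The symbol $(X,Y)$ denotes a non-trivial extension of $Y$ by $X$, i.e. the middle term of a non-split exact sequence $0\to X\to(X,Y)\to Y\to0$ of $\mathbb{Z}[G]$-modules; for $(A_i\oplus A_i',\Delta)$ the extension class is taken such that the module is indecomposable (non-zero components in both $\mathrm{Ext}^1(\Delta,A_i)$ and $\mathrm{Ext}^1(\Delta,A_i')$). By a theorem of Lee (1964), these modules are well defined up to isomorphism and the list $\mathbf{1},\epsilon,\Delta,A_i,A_i',(A_i',\mathbf{1}),(A_i,\epsilon),(A_i,\Delta),(A_i',\Delta),(A_i\oplus A_i',\Delta)$ ($i$ varying) is a complete list of non-isomorphic indecomposable $\mathbb{Z}$-free finite rank $\mathbb{Z}[G]$-modules. For a $\mathbb{Z}$-free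 finite rank $\mathbb{Z}[G]$-module $\Gamma$ and any non-degenerate $G$-invariant $\mathbb{Q}$-valued bilinear pairing $\langle\,,\rangle$ on $\Gamma$, $$\mathcal{C}_\Theta(\Gamma)=\frac{\det(\langle\,,\rangle|\Gamma)\cdot\det(\frac{1}{2p}\langle\,,\rangle|\Gamma^{G})^2}{\det(\frac12\langle\,,\rangle|\Gamma^{C_2})^2\cdot\det(\frac1p\langle\,,\rangle|\Gamma^{C_p})}\in\mathbb{Q}^\times,$$ with Gram determinants computed on $\mathbb{Z}$-bases (the determinant on the zero module is $1$); this is independent of the choice of the pairing (known result). *)

(* Defs.v *)
From HB Require Import structures.
From mathcomp Require Import all_boot all_order all_fingroup all_algebra.
From mathcomp Require Import all_solvable all_field.
From mathcomp Require Import boolp classical_sets.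
Set Implicit Arguments.
Unset Strict Implicit.
Unset Printing Implicit Defensive.
Import Order.TTheory GRing.Theory Num.Theory.
Local Open Scope ring_scope.
Local Obligation Tactic := idtac.

Record zgmodule (gT : finGroupType) := ZGModule {
  zg_sort :> zmodType;
  zg_act : gT -> zg_sort -> zg_sort;
  zg_act1 : forall x, zg_act 1%g x = x;
  zg_actM : forall g h x, zg_act (g * h)%g x = zg_act g (zg_act h x);
  zg_actB : forall g x y, zg_act g (x - y) = zg_act g x - zg_act g y }.

Section Modules.
Variable gT : finGroupType.
Implicit Types (M N X Y : zgmodule gT) (H : {group gT}).

Definition zg_hom M N (f : M -> N) : Prop :=
  (forall x y, f (x - y) = f x - f y) /\
  (forall g x, f (zg_act g x) = zg_act g (f x)).

Definition zg_fixed M H : set M :=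
  [set x | forall h, h \in H -> zg_act h x = x]%classic.

(* 0 -> X -> M -> Y -> 0: X is the submodule, Y the quotient *)
Definition short_exact X Y M (i : X -> M) (q : M -> Y) : Prop :=
  [/\ zg_hom i, zg_hom q, injective i, (forall y, exists m, q m = y)
    & forall m, q m = 0 <-> exists x, i x = m].

Definition splits Y M (q : M -> Y) : Prop :=
  exists r : Y -> M, zg_hom r /\ cancel r q.

Definition nontrivial_extension X Y M : Prop :=
  exists (i : X -> M) (q : M -> Y), short_exact i q /\ ~ splits q.

(* The image under h of the class of (i, q) in Ext^1(Y, X') is non-zero: it is
   the class of the bottom row of a morphism of extensions which is h on the
   left and the identity on the right. *)
Definition nonzero_pushforward X X' Y M (i : X -> M) (q : M -> Y)
    (h : X -> X') : Prop :=
  exists (M' : zgmodule gT) (i' : X' -> M') (q' : M' -> Y) (f : M -> M'),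
    [/\ short_exact i' q', zg_hom f, (forall x, f (i x) = i' (h x)),
        (forall m, q' (f m) = q m) & ~ splits q'].

Program Definition zg_sum M N : zgmodule gT :=
  @ZGModule gT (M * N)%type (fun g x => (zg_act g x.1, zg_act g x.2)) _ _ _.
Next Obligation. by move=> M N [x y] /=; rewrite !zg_act1. Qed.
Next Obligation. by move=> M N g h [x y] /=; rewrite !zg_actM. Qed.
Next Obligation.
by move=> M N g [x y] [x' y']; congr pair; rewrite /= zg_actB.
Qed.

(* Extensions of Y by X1 (+) X2 both of whose components, in Ext^1(Y, X1) and
   in Ext^1(Y, X2), are non-zero *)
Definition bi_nontrivial_extension X1 X2 Y M : Prop :=
  exists (i : zg_sum X1 X2 -> M) (q : M -> Y),
    [/\ short_exact i q, nonzero_pushforward i q (fun x => x.1 : X1)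
      & nonzero_pushforward i q (fun x => x.2 : X2)].

Program Definition zg_trivial : zgmodule gT :=
  @ZGModule gT int (fun _ x => x) _ _ _.
Solve All Obligations with done.

Section Permutation.
Variable H : {group gT}.
Definition coset_space : finType := {C : {set gT} | C \in lcosets H [set: gT]}.

Lemma coset_translate_subproof (g : gT) (C : coset_space) :
  (g *: val C)%g \in lcosets H [set: gT].
Proof.
case: C => C /= /lcosetsP[x _ ->]; apply/lcosetsP.
by exists (g * x)%g; rewrite ?inE // lcosetM.
Qed.
Definition coset_translate g C : coset_space :=
  Sub (g *: val C)%g (coset_translate_subproof g C).

(* Z[G/H]: the coset C is the indicator function of C, and g C the translate *)
Program Definition zg_perm : zgmodule gT :=
  @ZGModule gT {ffun coset_space -> int}
    (fun g f => [ffun C => f (coset_translate g^-1%g C)]) _ _ _.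
Next Obligation.
move=> f; apply/ffunP => C; rewrite ffunE; congr (f _); apply: val_inj.
by rewrite /= invg1 lcoset1.
Qed.
Next Obligation.
move=> g h f; apply/ffunP => C; rewrite !ffunE; congr (f _); apply: val_inj.
by rewrite /= invMg lcosetM.
Qed.
Next Obligation. by move=> g f f'; apply/ffunP => C; rewrite !ffunE. Qed.
End Permutation.

Section Submodule.
Variables (M : zgmodule gT) (P : set M).
Definition zg_stable : Prop :=
  [/\ P 0, forall x y, P x -> P y -> P (x - y)
    & forall g x, P x -> P (zg_act g x)].
Hypothesis Pst : zg_stable.

Definition sub_pred of zg_stable : {pred M} := fun x => `[< P x >].
Lemma sub_pred_closed : zmod_closed (sub_pred Pst).
Proof.
have [P0 PB _] := Pst; split; first exact/asboolP.
by move=> x y /asboolP Px /asboolP Py; apply/asboolP/PB.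
Qed.
HB.instance Definition _ :=
  GRing.isZmodClosed.Build M (sub_pred Pst) sub_pred_closed.
Definition sub_sort := {x : M | x \in sub_pred Pst}.
HB.instance Definition _ := SubChoice.on sub_sort.
HB.instance Definition _ := [SubChoice_isSubZmodule of sub_sort by <:].

Lemma sub_act_subproof g (x : sub_sort) : zg_act g (val x) \in sub_pred Pst.
Proof.
have [_ _ Pg] := Pst; have /asboolP Px := valP x; exact/asboolP/Pg.
Qed.

Program Definition zg_sub : zgmodule gT :=
  @ZGModule gT sub_sort
    (fun g x => Sub (zg_act g (val x)) (sub_act_subproof g x) : sub_sort) _ _ _.
Next Obligation. by move=> x; apply: val_inj; rewrite /= zg_act1. Qed.
Next Obligation. by move=> g h x; apply: val_inj; rewrite /= zg_actM. Qed.
Next Obligation. by move=> g x y; apply: val_inj; rewrite /= zg_actB. Qed.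
End Submodule.

Section DokchitserConstant.
Variable M : zgmodule gT.

Definition zbasis (L : set M) n (e : 'I_n -> M) : Prop :=
  (forall i, L (e i)) /\
  (forall x, L x -> exists! c : {ffun 'I_n -> int}, x = \sum_i e i *~ c i).

Definition zg_pairing (B : M -> M -> rat) : Prop :=
  [/\ (forall x y z, B (x - y) z = B x z - B y z) /\
      (forall x y z, B x (y - z) = B x y - B x z),
      forall g x y, B (zg_act g x) (zg_act g y) = B x y
    & (forall x, (forall y, B x y = 0) -> x = 0) /\
      (forall y, (forall x, B x y = 0) -> y = 0)].

(* Gram determinant on any Z-basis of L; 0 by default if there is none *)
Definition gram_det (B : M -> M -> rat) (L : set M) : rat :=
  xget 0 [set d | exists n (e : 'I_n -> M),
    zbasis L e /\ d = \det (\matrix_(i, j) B (e i) (e j))]%classic.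

(* A formal combination of subgroups \sum_H n_H H is the list of the (H, n_H).
   The constant is computed with any pairing; 0 by default if there is none. *)
Definition dokchitser (Theta : seq ({group gT} * int)) : rat :=
  xget 0 [set c | exists2 B, zg_pairing B &
    c = \prod_(t <- Theta)
          gram_det (fun x y => #|t.1|%:R^-1 * B x y) (zg_fixed t.1) ^ t.2]%classic.
End DokchitserConstant.

End Modules.

(* (s, w) is the pair of generators of the dihedral group of order 2p in the
   presentation <s, w : s^2 = w^p = (sw)^2 = 1> *)
Record dihedral_gens (gT : finGroupType) (p : nat) (s w : gT) : Prop :=
  DihedralGens {
    dih_isog : [set: gT]%g \isog [set: 'D_(p.*2)]%g;
    dih_gen : <<[set s; w]>>%g = [set: gT]%g;
    dih_s : (s ^+ 2 = 1)%g;
    dih_w : (w ^+ p = 1)%g;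
    dih_sw : ((s * w) ^+ 2 = 1)%g }.

Definition Theta_dihedral (gT : finGroupType) (s w : gT) :
    seq ({group gT} * int) :=
  [:: (1%G, 1); (<[s]>%G, -2); (<[w]>%G, -1); ([set: gT]%G, 2)].

(* A Z[G]-module is an abelian group with additive automorphisms s, w subject
   to the relations of the presentation of G. *)
Section DihedralModule.
Variables (gT : finGroupType) (p : nat) (s w : gT).
Hypotheses (p_pr : prime p) (dih : dihedral_gens p s w).

Fact dih_card : #|gT| = p.*2.
Proof.
by rewrite -cardsT (card_isog (dih_isog dih)) card_dihedral // prime_gt1.
Qed.

Fact dih_order : #[w]%g = p.
Proof.
have /primeP[_ /(_ #[w]%g)] := p_pr.
rewrite order_dvdn (dih_w dih) eqxx => /(_ isT)/orP[] /eqP // /eqP.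
rewrite order_eq1 => /eqP w1.
have : [set: gT]%g \subset <[s]>%g.
  by rewrite -(dih_gen dih) gen_subG finset.subUset !finset.sub1set cycle_id w1 group1.
move/subset_leq_card; rewrite cardsT dih_card => le_s.
have: (#[s]%g <= 2)%N by rewrite dvdn_leq // order_dvdn (dih_s dih).
by move/(leq_trans le_s); rewrite (@leq_double p 1) leqNgt prime_gt1.
Qed.

Fact dih_notin : s \notin <[w]>%g.
Proof.
apply/negP => sw; have : [set: gT]%g \subset <[w]>%g.
  by rewrite -(dih_gen dih) gen_subG finset.subUset !finset.sub1set cycle_id sw.
move/subset_leq_card; rewrite cardsT dih_card -/(#[w]%g) dih_order.
by rewrite -addnn -{3}(addn0 p) leq_add2l leqNgt prime_gt0.
Qed.

Fact dih_conj k : (s * w ^+ k = w ^- k * s)%g.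
Proof.
have ss: (s * s = 1)%g by rewrite -expg2 (dih_s dih).
have sV: (s^-1 = s)%g by apply/eqP; rewrite eq_invg_mul ss.
have: (w ^ s = w^-1)%g.
  apply/eqP; rewrite eq_sym eq_invg_mul conjgE sV.
  have := dih_sw dih; rewrite expg2 -!mulgA => swsw.
  apply/eqP/(mulgI s); rewrite mulg1 -[RHS]mul1g -[in RHS]swsw.
  by rewrite -!mulgA.
move/(congr1 (fun x => x ^+ k))%g; rewrite -conjXg expVgn => <-.
by rewrite conjgE sV -!mulgA ss mulg1.
Qed.

Definition dih_word (c : 'I_p * bool) : gT := (w ^+ c.1 * s ^+ c.2)%g.
Fact dih_word_bij : bijective dih_word.
Proof.
apply: inj_card_bij; last by rewrite card_prod card_ord card_bool dih_card muln2.
move=> [k e] [k' e']; rewrite /dih_word /= => E.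
suff ee: e = e'.
  move: E; rewrite ee => /mulIg /eqP; rewrite eq_expg_mod_order dih_order.
  by rewrite !modn_small // => /eqP/val_inj->.
have : (s ^+ e * s ^- e' \in <[w]>)%g.
  rewrite -[X in (X * _)%g](mulKg (w ^+ k)%g) E -!mulgA mulgV mulg1.
  by rewrite groupM ?groupV ?mem_cycle.
by case: e e' {E} => [] [] //=; rewrite expg0 expg1 ?invg1 ?mulg1 ?mul1g ?groupV
   (negPf dih_notin).
Qed.

(* (k, e) such that g = w^k s^e; the default value is not reached *)
Definition dih_coord (g : gT) : nat * bool :=
  if [pick c | dih_word c == g] is Some c then (val c.1, c.2) else (0, false).

Fact dih_coordP k e : dih_coord (w ^+ k * s ^+ (e : bool))%g = ((k %% p)%N, e).
Proof.
have kp: (k %% p < p)%N by rewrite ltn_mod prime_gt0.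
have E: dih_word (Ordinal kp, e) = (w ^+ k * s ^+ e)%g.
  by rewrite /dih_word /= expg_mod ?(dih_w dih).
rewrite /dih_coord; case: pickP => [c /eqP|/(_ (Ordinal kp, e))/eqP//].
by rewrite -E => /(bij_inj dih_word_bij) ->.
Qed.

Variables (V : zmodType) (a b : V -> V).
Hypotheses (aB : {morph a : x y / x - y}) (bB : {morph b : x y / x - y}).
Hypotheses (aa : forall x, a (a x) = x) (bp : forall x, iter p b x = x).
Hypothesis (abab : forall x, a (b (a (b x))) = x).

Definition dih_act g x := iter (dih_coord g).1 b (iter (dih_coord g).2 a x).

Fact dih_iter_mod k x : iter (k %% p) b x = iter k b x.
Proof.
rewrite {2}(divn_eq k p) addnC iterD; congr iter.
by elim: (k %/ p)%N => //= n IH; rewrite mulSn iterD -IH bp.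
Qed.

Fact dih_actE k e x :
  dih_act (w ^+ k * s ^+ (e : bool))%g x = iter k b (iter e a x).
Proof. by rewrite /dih_act dih_coordP /= dih_iter_mod. Qed.

Fact dih_actB g x y : dih_act g (x - y) = dih_act g x - dih_act g y.
Proof.
rewrite /dih_act; set n := nat_of_bool _.
have -> : iter n a (x - y) = iter n a x - iter n a y.
  by elim: n => //= n ->; rewrite aB.
by elim: (_.1) => //= k ->; rewrite bB.
Qed.

Fact dih_act1 x : dih_act 1%g x = x.
Proof. by have := dih_actE 0 false x; rewrite !expg0 mulg1. Qed.

Fact dih_braid k x : iter k b (a (iter k b x)) = a x.
Proof.
have bab y : b (a (b y)) = a y by rewrite -[in RHS](abab y) aa.
by elim: k x => //= k IH x; rewrite -iterS iterSr bab IH.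
Qed.

Fact dih_actM g h x : dih_act (g * h)%g x = dih_act g (dih_act h x).
Proof.
have [f _ fK] := dih_word_bij.
rewrite -(fK g) -(fK h); case: (f g) => k e; case: (f h) => l d.
rewrite /dih_word /= !dih_actE; case: e => /=; last first.
  by rewrite expg0 mulg1 mulgA -expgD dih_actE iterD.
have wl: (w ^- l = w ^+ (p - l))%g.
  apply/eqP; rewrite eq_invg_mul -expgD subnKC ?(dih_w dih) //.
  exact: ltnW.
have -> : (w ^+ k * s * (w ^+ l * s ^+ d) = w ^+ (k + (p - l)) * s ^+ (~~ d))%g.
  rewrite expgD -wl -!mulgA; congr mulg; rewrite mulgA dih_conj -mulgA.
  by congr mulg; case: d => /=; rewrite ?expg0 ?mulg1 // expg1 -expg2 (dih_s dih).
rewrite dih_actE iterD; congr iter.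
apply: etrans (_ : iter (p - l) b (iter l b (a (iter l b (iter d a x)))) = _).
  by rewrite dih_braid; case: d => //=; rewrite aa.
by rewrite -iterD subnK ?bp // ltnW.
Qed.

Definition dih_module : zgmodule gT :=
  ZGModule dih_act1 dih_actM dih_actB.

Fact dih_module_s x : zg_act s (x : dih_module) = a x.
Proof. by have := dih_actE 0 true x; rewrite expg0 mul1g. Qed.

Fact dih_module_w x : zg_act w (x : dih_module) = b x.
Proof. by have := dih_actE 1 false x; rewrite mulg1. Qed.
End DihedralModule.

Section DihedralCharacters.
Variables (gT : finGroupType) (p : nat) (s w : gT).
Hypotheses (p_pr : prime p) (dih : dihedral_gens p s w).

Fact zg_sign_subproof (x : int) : iter p (fun y => y) x = x.
Proof. by elim: p => //= n ->. Qed.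

Definition zg_sign : zgmodule gT :=
  @dih_module gT p s w p_pr dih int (fun x => - x) (fun x => x)
    (fun x y => opprD x (- y)) (fun _ _ => erefl) (@opprK _) zg_sign_subproof (@opprK _).
End DihedralCharacters.

Section CyclotomicSets.
Variable z : algC.

Definition cyclo_int : set algC :=
  [set x | exists q : {poly int}, x = (map_poly intr q).[z]]%classic.

Definition cyclo_field : set algC :=
  [set x | exists q : {poly rat}, x = (map_poly ratr q).[z]]%classic.

(* The ring of integers of the maximal real subfield of Q(z) *)
Definition real_cyclo_int : set algC :=
  [set x | [/\ cyclo_field x, x \is Creal & x \in Aint]]%classic.

(* Non-zero integral ideals of that ring, which represent all ideal classes *)
Record real_ideal := RealIdeal {
  ideal_set :> set algC;
  ideal_sub : forall x, ideal_set x -> real_cyclo_int x;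
  ideal0 : ideal_set 0;
  idealB : forall x y, ideal_set x -> ideal_set y -> ideal_set (x - y);
  idealM : forall c x, real_cyclo_int c -> ideal_set x -> ideal_set (c * x);
  ideal_neq0 : exists2 x, ideal_set x & x != 0 }.

Definition ideal_equiv (I J : real_ideal) : Prop :=
  exists a b, [/\ real_cyclo_int a, real_cyclo_int b, a != 0, b != 0 &
    [set a * x | x in (I : set algC)] = [set b * x | x in (J : set algC)]]%classic.

Definition represents_class_group (T : Type) (U : T -> real_ideal) : Prop :=
  forall J, exists! i, ideal_equiv (U i) J.

(* U Z[z] *)
Definition extended_ideal (U : real_ideal) : set algC :=
  [set x | exists r : seq (algC * algC),
    (forall t, t \in r -> ideal_set U t.1 /\ cyclo_int t.2) /\
    x = \sum_(t <- r) t.1 * t.2]%classic.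

(* (z^* - z) U Z[z] *)
Definition twisted_ideal (U : real_ideal) : set algC :=
  [set (z^* - z) * x | x in extended_ideal U]%classic.
End CyclotomicSets.

Section CyclotomicModules.
Variables (gT : finGroupType) (p : nat) (s w : gT) (z : algC).
Hypotheses (p_pr : prime p) (dih : dihedral_gens p s w).
Hypothesis (z_prim : p.-primitive_root z).

Fact conj_prim : z^* = z ^+ p.-1.
Proof.
have zp := prim_expr_order z_prim; have p0 := prime_gt0 p_pr.
have nz: `|z| = 1 by apply/eqP; rewrite -(@pexpr_eq1 _ _ p) // -normrX zp normr1.
have z0 : z != 0 by rewrite -normr_gt0 nz ltr01.
by apply: (mulfI z0); rewrite -normCK nz expr1n -exprS prednK.
Qed.

Fact conj_mul_prim : z * z^* = 1.
Proof. by rewrite conj_prim -exprS prednK ?prime_gt0 // prim_expr_order. Qed.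

Fact mul_iter x : iter p ( *%R z) x = x.
Proof.
have -> n : iter n ( *%R z) x = z ^+ n * x.
  by elim: n => [|n IH]; rewrite ?mul1r // iterS IH exprS mulrA.
by rewrite prim_expr_order ?mul1r.
Qed.

Fact conj_mul_conj x : (z * (z * x)^*)^* = x.
Proof.
rewrite !rmorphM /= !conjCK mulrA [z^* * z]mulrC.
by rewrite conj_mul_prim mul1r.
Qed.

Definition zg_complex : zgmodule gT :=
  @dih_module gT p s w p_pr dih algC (fun x => x^*) ( *%R z)
    (rmorphB _) (mulrBr z) (@conjCK _) mul_iter conj_mul_conj.

Fact cyclo_intB x y : cyclo_int z x -> cyclo_int z y -> cyclo_int z (x - y).
Proof.
move=> [q ->] [r ->]; exists (q - r).
by rewrite rmorphB /= hornerD hornerN.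
Qed.

Fact cyclo_int_mulz x : cyclo_int z x -> cyclo_int z (z * x).
Proof.
move=> [q ->]; exists ('X * q).
by rewrite rmorphM /= map_polyX hornerM hornerX.
Qed.

Fact cyclo_int_conj x : cyclo_int z x -> cyclo_int z x^*.
Proof.
move=> [q ->]; exists (q \Po 'X^(p.-1)).
rewrite -horner_map -map_poly_comp map_comp_poly map_polyXn horner_comp hornerXn.
rewrite -conj_prim; congr (_.[_]); apply: eq_map_poly => c /=.
exact: rmorph_int.
Qed.

Variable U : real_ideal z.

Fact extended_idealB x y :
  extended_ideal U x -> extended_ideal U y -> extended_ideal U (x - y).
Proof.
move=> [r [rU ->]] [r' [rU' ->]].
exists (r ++ [seq (t.1, - t.2) | t <- r']); split; last first.
  rewrite big_cat big_map /= -sumrN; congr (_ + _).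
  by apply: eq_bigr => t _; rewrite mulrN.
move=> t; rewrite mem_cat => /orP[/rU//|/mapP[u /rU'[? ?] ->]]; split=> //=.
rewrite -[- _]add0r; apply: cyclo_intB => //.
by exists 0; rewrite rmorph0 horner0.
Qed.

Fact extended_ideal_mulz x : extended_ideal U x -> extended_ideal U (z * x).
Proof.
move=> [r [rU ->]]; exists [seq (t.1, z * t.2) | t <- r]; split.
  by move=> t /mapP[u /rU[? ?] ->]; split=> //; apply: cyclo_int_mulz.
rewrite big_map mulr_sumr; apply: eq_bigr => t _.
by rewrite /= mulrCA.
Qed.

Fact extended_ideal_conj x : extended_ideal U x -> extended_ideal U x^*.
Proof.
move=> [r [rU ->]]; exists [seq (t.1, t.2^* ) | t <- r]; split.
  by move=> t /mapP[u /rU[? ?] ->]; split=> //; apply: cyclo_int_conj.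
rewrite big_map rmorph_sum; apply: eq_big_seq => t /rU[Ut _].
rewrite rmorphM /=; congr (_ * _); apply/CrealP.
by case: (ideal_sub Ut).
Qed.

Fact complex_stable (P : set algC) :
  P 0 -> (forall x y, P x -> P y -> P (x - y)) ->
  (forall x, P x -> P x^* ) -> (forall x, P x -> P (z * x)) ->
  zg_stable (P : set zg_complex).
Proof.
move=> P0 PB Pc Pz; split=> // g x Px; rewrite /= /dih_act.
have Pi n f : (forall x, P x -> P (f x)) -> forall x, P x -> P (iter n f x).
  by move=> Pf y Py; elim: n => //= n; apply: Pf.
by apply: (Pi) Pz _ _; apply: (Pi) Pc _ _.
Qed.

Fact extended_ideal0 : extended_ideal U 0.
Proof. by exists [::]; rewrite big_nil. Qed.

Fact zg_A_subproof : zg_stable (extended_ideal U : set zg_complex).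
Proof.
exact: complex_stable extended_ideal0 extended_idealB extended_ideal_conj
  extended_ideal_mulz.
Qed.

Fact zg_A'_subproof : zg_stable (twisted_ideal U : set zg_complex).
Proof.
apply: complex_stable.
- by exists 0; [exact: extended_ideal0 | rewrite mulr0].
- move=> _ _ [x Ux <-] [y Uy <-]; exists (x - y); last by rewrite mulrBr.
  exact: extended_idealB.
- move=> _ [x Ux <-]; exists (0 - x^* ).
    exact/extended_idealB/extended_ideal_conj/Ux/extended_ideal0.
  by rewrite rmorphM rmorphB /= conjCK sub0r mulrN -mulNr opprB.
move=> _ [x Ux <-]; exists (z * x); last by rewrite mulrCA.
exact: extended_ideal_mulz.
Qed.

Definition zg_A : zgmodule gT := zg_sub zg_A_subproof.
Definition zg_A' : zgmodule gT := zg_sub zg_A'_subproof.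
End CyclotomicModules.

(* Main.v *)
From HB Require Import structures.
Require Import Defs.
From mathcomp Require Import all_boot all_order all_fingroup all_algebra.
From mathcomp Require Import all_solvable all_field.
From mathcomp Require Import boolp classical_sets ring zify.
Set Implicit Arguments.
Unset Strict Implicit.
Unset Printing Implicit Defensive.
Import Order.TTheory GRing.Theory Num.Theory.
Local Open Scope ring_scope.

(** Let [X] be the kernel of the norm of [C_p = <w>] on a lattice [M], and
    [Y = M / X], on which [C_p] acts trivially. Invariance of a pairing makes
    [M^{C_p}] orthogonal to [X], and [X] and [M^{C_p}] together have finite index
    in [M]. Hence each of the four Gram determinants in the constant is a
    determinant on the [X] side times a determinant on the [Y] side, up to the
    square of an index. The determinants on the [Y] side cancel up to powers of
    [p], since [M^{C_p}] and [M^G] occur in two determinants each, and what is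
    left is

      C(M) = k * [Y^s : P^s]^4 / [Y : P]^2 * p^(rank Y - 2 rank Y^s),

    where [P] is the image of [M^{C_p}] in [Y], and [k] is the quotient of the
    determinant on [X] by the square of the one on [X^s] for half the pairing.
    This is [dokchitser_extension].

    The factor [k] depends on [X] only. Let [R] be the ring of integers of the
    real cyclotomic field and [U] an ideal of it. As [U] is stable under
    [tau = z + z^*], the ideal [U Z[z]] is [U + U z], with real part [U], and
    in terms of the Gram matrix [S] on [U] and of the matrix [T] of [tau] its
    Gram matrix has the blocks [S], [(1/2) T S], [(1/2) T S], [S]
    ([gram_rotation]). So [k = det (4 - T^2)]. The characteristic polynomial of
    multiplication by [z] on [U Z[z]] is the cyclotomic polynomial, whose values
    at 1 and -1 are [p] and 1; these are [det (2 - T)] and [det (2 + T)]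
    ([det_cyclo_companion]). This gives [k = p] for [A]. For [A'], where [s]
    acts by minus the conjugation, the shift by [w^-1 - w] leads back to vectors
    fixed by [s] at the cost of the index [p], squared, and [k = 1/p]; for the
    direct sum the same computation gives [k = 1] ([gram_cyclotomic]).

    It remains to find [P]. It contains [p Y], and [P = Y] would split the
    extension ([lift_image_splits]). The obstruction to lifting an element of
    [Y] to [M^{C_p}] lies in [X / (w - 1) X], and is equivariant up to the sign
    that [s] acquires from [s w = w^-1 s]; since [s] acts on [A / (w - 1) A] by 1
    and on [A' / (w - 1) A'] by -1, extensions by [A] are only obstructed on the
    part of [Y] where [s] is -1, and extensions by [A'] where [s] is 1
    ([lift_sign]). So [P = p Y] when [Y] has rank one, and when [Y] is [Delta],
    with basis [e], [f], the element [a e + b f] belongs to [P] exactly when [p]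
    divides [a - b] for [A], divides [a + b] for [A'], and divides both for the
    direct sum ([regular_lift]). *)

(** * Finite families in abelian groups and their Gram matrices *)

Section Families.
Variable V : zmodType.
Implicit Types (L : set V).

Definition zsubgroup L := L 0 /\ forall x y, L x -> L y -> L (x - y).

Definition lincomb n (e : 'I_n -> V) (c : 'rV[int]_n) : V :=
  \sum_i e i *~ c 0 i.

(** The product of the matrix [P] by the column of the vectors [e]. Families
    are indexed by ordinals so that Gram determinants are determinants of
    matrices. *)
Definition fammul m n (P : 'M[int]_(m, n)) (e : 'I_n -> V) : 'I_m -> V :=
  fun i => lincomb e (row i P).

Definition famcat m n (e : 'I_m -> V) (f : 'I_n -> V) : 'I_(m + n) -> V :=
  fun i => match split i with inl j => e j | inr j => f j end.

Definition zfree_basis L n (e : 'I_n -> V) :=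
  [/\ forall i, L (e i), forall x, L x -> exists c, x = lincomb e c
    & forall c, lincomb e c = 0 -> c = 0].

Lemma lincombB n (e : 'I_n -> V) a b :
  lincomb e (a - b) = lincomb e a - lincomb e b.
Proof.
rewrite /lincomb -sumrB; apply: eq_bigr => i _.
by rewrite !mxE mulrzBr.
Qed.

Lemma lincomb0 n (e : 'I_n -> V) : lincomb e 0 = 0.
Proof. by rewrite -[X in lincomb e X](subrr 0) lincombB subrr. Qed.

Lemma lincombD n (e : 'I_n -> V) a b :
  lincomb e (a + b) = lincomb e a + lincomb e b.
Proof. by rewrite -[a in RHS](addrK b) lincombB subrK. Qed.

Lemma lincombN n (e : 'I_n -> V) a : lincomb e (- a) = - lincomb e a.
Proof. by rewrite -[- a]sub0r lincombB lincomb0 sub0r. Qed.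

Lemma lincomb_delta n (e : 'I_n -> V) i : lincomb e (delta_mx 0 i) = e i.
Proof.
rewrite /lincomb (bigD1 i) //= big1 => [|j /negPf ji].
  by rewrite !mxE !eqxx mulr1z addr0.
by rewrite !mxE ji andbF mulr0z.
Qed.

Lemma lincomb_fammul m n (P : 'M_(m, n)) (e : 'I_n -> V) c :
  lincomb (fammul P e) c = lincomb e (c *m P).
Proof.
rewrite /lincomb /fammul /lincomb.
under eq_bigr do rewrite mulrz_suml.
rewrite exchange_big /=; apply: eq_bigr => j _; rewrite mxE mulrz_sumr.
by apply: eq_bigr => i _; rewrite mxE -mulrzA mulrC.
Qed.

Lemma fammulA l m n (Q : 'M_(l, m)) (P : 'M_(m, n)) e i :
  fammul Q (fammul P e) i = fammul (Q *m P) e i.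
Proof. by rewrite /fammul row_mul; exact: lincomb_fammul. Qed.

Lemma famcat_l m n (e : 'I_m -> V) (f : 'I_n -> V) i :
  famcat e f (lshift n i) = e i.
Proof. by rewrite /famcat (unsplitK (inl i)). Qed.

Lemma famcat_r m n (e : 'I_m -> V) (f : 'I_n -> V) i :
  famcat e f (rshift m i) = f i.
Proof. by rewrite /famcat (unsplitK (inr i)). Qed.

Lemma eq_lincomb n (e f : 'I_n -> V) c : e =1 f -> lincomb e c = lincomb f c.
Proof. by move=> ef; apply: eq_bigr => i _; rewrite ef. Qed.

Lemma lincomb_cat m n (e : 'I_m -> V) (f : 'I_n -> V) a b :
  lincomb (famcat e f) (row_mx a b) = lincomb e a + lincomb f b.
Proof.
rewrite /lincomb big_split_ord /=; congr (_ + _).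
  by apply: eq_bigr => i _; rewrite famcat_l row_mxEl.
by apply: eq_bigr => i _; rewrite famcat_r row_mxEr.
Qed.

Lemma famcatP m n (e : 'I_m -> V) (f : 'I_n -> V) (P : V -> Prop) :
  (forall i, P (e i)) -> (forall i, P (f i)) -> forall i, P (famcat e f i).
Proof. by move=> Pe Pf i; rewrite /famcat; case: split. Qed.

Lemma zsubgroupN L x : zsubgroup L -> L x -> L (- x).
Proof. by move=> [L0 LB]; rewrite -sub0r; apply: LB. Qed.

Lemma zsubgroupD L x y : zsubgroup L -> L x -> L y -> L (x + y).
Proof.
move=> Lg Lx Ly; rewrite -[y]opprK.
exact: Lg.2 Lx (zsubgroupN Lg Ly).
Qed.

Lemma zsubgroupMz L x (k : int) : zsubgroup L -> L x -> L (x *~ k).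
Proof.
move=> Lg; have Ln (m : nat) y : L y -> L (y *+ m).
  move=> Ly; elim: m => [|m IH]; first by rewrite mulr0n; case: Lg.
  by rewrite mulrS; apply: zsubgroupD.
by case: k => k Lx; [apply: Ln | apply/(zsubgroupN Lg)/Ln].
Qed.

Lemma zsubgroup_lincomb L n (e : 'I_n -> V) c :
  zsubgroup L -> (forall i, L (e i)) -> L (lincomb e c).
Proof.
move=> Lg Le; rewrite /lincomb; elim/big_ind: _ => [|x y|i _].
- by case: Lg.
- exact: zsubgroupD.
- exact: zsubgroupMz.
Qed.

Lemma zfree_inj L n (e : 'I_n -> V) a b :
  zfree_basis L e -> lincomb e a = lincomb e b -> a = b.
Proof.
by move=> [_ _ fr] ab; apply/subr0_eq/fr; rewrite lincombB ab subrr.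
Qed.

Lemma zfree_coord L n (e : 'I_n -> V) m (f : 'I_m -> V) :
  zfree_basis L e -> (forall i, L (f i)) ->
  exists P : 'M_(m, n), f =1 fammul P e.
Proof.
move=> [_ sp _] Lf.
have /choice[c cP] i : exists c, f i = lincomb e c by apply/sp/Lf.
exists (\matrix_i c i) => i; rewrite /fammul cP; congr lincomb.
by rewrite rowK.
Qed.

Lemma eq_zfree L L' n (e e' : 'I_n -> V) :
  (forall x, L x <-> L' x) -> e =1 e' -> zfree_basis L e -> zfree_basis L' e'.
Proof.
move=> LL' ee' [Le sp fr]; split.
- by move=> i; rewrite -ee'; apply/LL'.
- by move=> x /LL'/sp[c ->]; exists c; apply: eq_lincomb.
- by move=> c; rewrite -(eq_lincomb c ee'); apply: fr.
Qed.

End Families.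

Section FamilyMaps.
Variables (V W : zmodType) (f : V -> W).
Hypothesis fB : forall x y, f (x - y) = f x - f y.

Lemma zmap0 : f 0 = 0.
Proof. by rewrite -[X in f X](subrr 0) fB subrr. Qed.

Lemma zmapD x y : f (x + y) = f x + f y.
Proof. by rewrite -[in LHS](opprK y) fB -[- y]sub0r fB zmap0 sub0r opprK. Qed.

Lemma zmapN x : f (- x) = - f x.
Proof. by rewrite -sub0r fB zmap0 sub0r. Qed.

Lemma zmap_lincomb n (e : 'I_n -> V) c :
  f (lincomb e c) = lincomb (f \o e) c.
Proof.
pose F : {additive V -> W} := HB.pack f (GRing.isZmodMorphism.Build V W f fB).
rewrite -[LHS]/(F _) raddf_sum; apply: eq_bigr => i _.
exact: (raddfMz F).
Qed.

Lemma zmapMz x (k : int) : f (x *~ k) = f x *~ k.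
Proof.
pose F : {additive V -> W} := HB.pack f (GRing.isZmodMorphism.Build V W f fB).
exact: (raddfMz F).
Qed.

Lemma zmap_sum (I : Type) (r : seq I) (P : pred I) (F : I -> V) :
  f (\sum_(i <- r | P i) F i) = \sum_(i <- r | P i) f (F i).
Proof.
by elim/big_ind2: _; [exact: zmap0 | move=> ? ? ? ? <- <-; exact: zmapD|].
Qed.

Lemma zmapMn x k : f (x *+ k) = f x *+ k.
Proof. by elim: k => [|k IH]; rewrite ?mulr0n ?zmap0 // !mulrS zmapD IH. Qed.

(** The sublattices of invariants of an extension are extensions themselves,
    and their bases are obtained in this way. *)
Lemma zfree_extension (L K : set V) (LW : set W) m n
    (x : 'I_m -> V) (y : 'I_n -> V) :
  zsubgroup L -> (forall v, K v <-> L v /\ f v = 0) ->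
  (forall v, L v -> LW (f v)) -> (forall i, L (y i)) ->
  zfree_basis K x -> zfree_basis LW (f \o y) ->
  zfree_basis L (famcat x y).
Proof.
move=> Lg KL LLW Ly [Kx spx frx] [_ spy fry].
have fx c : f (lincomb x c) = 0.
  rewrite zmap_lincomb /lincomb big1 // => i _ /=.
  by have /KL[_ ->] := Kx i; rewrite mul0rz.
split.
- by apply: famcatP => // i; have /KL[] := Kx i.
- move=> v Lv; have [b fv] := spy _ (LLW v Lv).
  have /KL/spx[a va] : L (v - lincomb y b) /\ f (v - lincomb y b) = 0.
    split; first by apply: Lg.2 => //; apply: zsubgroup_lincomb.
    by rewrite fB fv zmap_lincomb subrr.
  by exists (row_mx a b); rewrite lincomb_cat -va subrK.
- move=> c; rewrite -[c]hsubmxK lincomb_cat => c0.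
  have r0 : rsubmx c = 0.
    by apply: fry; rewrite -zmap_lincomb -(add0r (f _)) -(fx (lsubmx c)) -zmapD c0 zmap0.
  move: c0; rewrite r0 lincomb0 addr0 => /frx ->.
  exact: row_mx0.
Qed.

Lemma zfree_iso (L : set V) (LW : set W) n (y : 'I_n -> V) :
  zsubgroup L -> (forall v, L v -> f v = 0 -> v = 0) ->
  (forall v, L v -> LW (f v)) -> (forall i, L (y i)) ->
  zfree_basis LW (f \o y) -> zfree_basis L y.
Proof.
move=> Lg inj LLW Ly [_ spy fry]; split=> //.
  move=> v Lv; have [b fv] := spy _ (LLW v Lv).
  exists b; apply/subr0_eq/inj.
    by apply: Lg.2 => //; apply: zsubgroup_lincomb.
  by rewrite fB fv zmap_lincomb subrr.
by move=> c c0; apply: fry; rewrite -zmap_lincomb c0 zmap0.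
Qed.
End FamilyMaps.

Notation "P ^Q" := (map_mx (intr : int -> rat) P) (at level 2, format "P ^Q").

Section Gram.
Variable V : zmodType.
Implicit Types (B : V -> V -> rat).

Definition biadditive B :=
  (forall x y z, B (x - y) z = B x z - B y z) /\
  (forall x y z, B x (y - z) = B x y - B x z).

Definition crossgram B m n (e : 'I_m -> V) (f : 'I_n -> V) : 'M[rat]_(m, n) :=
  \matrix_(i, j) B (e i) (f j).

Lemma lincombE_l B m (e : 'I_m -> V) c v :
  biadditive B -> B (lincomb e c) v = \sum_i (c 0 i)%:~R * B (e i) v.
Proof.
move=> [Bl _]; rewrite (zmap_lincomb (f := B^~ v)) //; apply: eq_bigr => i _.
by rewrite mulrzl.
Qed.

Lemma lincombE_r B m (e : 'I_m -> V) c v :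
  biadditive B -> B v (lincomb e c) = \sum_i B v (e i) * (c 0 i)%:~R.
Proof.
move=> [_ Br]; rewrite (zmap_lincomb (f := B v)) //; apply: eq_bigr => i _.
by rewrite mulrzr.
Qed.

Lemma crossgram_fammul B m n m' n' (P : 'M_(m', m)) (Q : 'M_(n', n))
    (e : 'I_m -> V) (f : 'I_n -> V) : biadditive B ->
  crossgram B (fammul P e) (fammul Q f) = P^Q *m crossgram B e f *m Q^Q^T.
Proof.
move=> bB; apply/matrixP => i j; rewrite !mxE lincombE_r //.
apply: eq_bigr => k _; rewrite !mxE lincombE_l //; congr (_ * _).
by apply: eq_bigr => l _; rewrite !mxE.
Qed.

Lemma eq_crossgram B m n (e e' : 'I_m -> V) (f f' : 'I_n -> V) :
  e =1 e' -> f =1 f' -> crossgram B e f = crossgram B e' f'.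
Proof. by move=> ee ff; apply/matrixP => i j; rewrite !mxE ee ff. Qed.

Lemma crossgram_cat B m n m' n' (e : 'I_m -> V) (e' : 'I_m' -> V)
    (f : 'I_n -> V) (f' : 'I_n' -> V) :
  crossgram B (famcat e e') (famcat f f') =
  block_mx (crossgram B e f) (crossgram B e f')
           (crossgram B e' f) (crossgram B e' f').
Proof.
apply/matrixP => i j; rewrite !mxE /famcat.
by case: (split i) => k; rewrite !mxE; case: (split j) => l; rewrite mxE.
Qed.

Definition gram B n (e : 'I_n -> V) : rat := \det (crossgram B e e).

Lemma gram_fammul B n (P : 'M_n) (e : 'I_n -> V) : biadditive B ->
  gram B (fammul P e) = (\det P)%:~R ^+ 2 * gram B e.
Proof.
move=> bB; rewrite /gram crossgram_fammul // !det_mulmx det_tr det_map_mx.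
by rewrite mulrAC expr2.
Qed.

Lemma eq_gram B n (e e' : 'I_n -> V) : e =1 e' -> gram B e = gram B e'.
Proof. by move=> ee; congr (\det _); apply: eq_crossgram. Qed.

Lemma gram_scale B a n (e : 'I_n -> V) :
  gram (fun x y => a * B x y) e = a ^+ n * gram B e.
Proof.
rewrite /gram -detZ; congr (\det _).
by apply/matrixP => i j; rewrite !mxE.
Qed.

Lemma gram_cat_orth B m n (e : 'I_m -> V) (f : 'I_n -> V) :
  (forall i j, B (e i) (f j) = 0) ->
  gram B (famcat e f) = gram B e * gram B f.
Proof.
move=> ef; rewrite /gram crossgram_cat.
have -> : crossgram B e f = 0 by apply/matrixP => i j; rewrite !mxE ef.
by rewrite det_lblock.
Qed.

Lemma zfree_size (L : set V) m n (e : 'I_m -> V) (f : 'I_n -> V) :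
  zfree_basis L e -> zfree_basis L f -> (m <= n)%N.
Proof.
move=> be bf; have [Le _ _] := be; have [Lf _ _] := bf.
have [P eP] := zfree_coord bf Le; have [Q fQ] := zfree_coord be Lf.
have PQ : P *m Q = 1%:M.
  apply/row_matrixP => i; apply: (zfree_inj be).
  rewrite row1 lincomb_delta eP row_mul -lincomb_fammul.
  by apply: eq_lincomb => j; rewrite fQ.
have PQ' : P^Q *m Q^Q = 1%:M by rewrite -map_mxM PQ map_mx1.
by rewrite -(mxrank1 rat m) -PQ' (leq_trans (mxrankM_maxl _ _)) // rank_leq_col.
Qed.

(** The transition matrices in both directions are integral, so that their
    determinants are 1 or -1. *)
Lemma gram_basis_indep B (L : set V) m n (e : 'I_m -> V) (f : 'I_n -> V) :
  biadditive B -> zfree_basis L e -> zfree_basis L f -> gram B e = gram B f.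
Proof.
move=> bB be bf.
have mn : m = n by apply/eqP; rewrite eqn_leq (zfree_size be bf) (zfree_size bf be).
case: n / mn in f bf *; have [Le _ _] := be; have [Lf _ _] := bf.
have [P eP] := zfree_coord bf Le; have [Q fQ] := zfree_coord be Lf.
have PQ : P *m Q = 1%:M.
  apply/row_matrixP => i; apply: (zfree_inj be).
  rewrite row1 lincomb_delta eP row_mul -lincomb_fammul.
  by apply: eq_lincomb => j; rewrite fQ.
have : \det Q * \det P = 1 by rewrite mulrC -det_mulmx PQ det1.
rewrite (eq_gram _ eP) gram_fammul // => /intUnitRing.unitzPl.
by case/orP => /eqP ->; rewrite ?rmorphN expr2 ?mulrNN rmorph1 mulr1 mul1r.
Qed.
End Gram.

(** * Invariant pairings and the constant computed from bases *)

Notation invariants M H := (@zg_fixed _ M H).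

Lemma clear_denominators n (v : 'rV[rat]_n) :
  exists2 k : int, k != 0 & exists c : 'rV[int]_n, k%:~R *: v = c^Q.
Proof.
pose k := \prod_i denq (v 0 i).
exists k; first by apply/prodf_neq0 => i _; rewrite denq_neq0.
exists (\row_i ((\prod_(j | j != i) denq (v 0 j)) * numq (v 0 i))).
apply/rowP => i; rewrite !mxE rmorphM /= numqE /k (bigD1 i) //= rmorphM /=.
by rewrite -mulrA mulrCA [RHS]mulrCA [v 0 i * _]mulrC mulrA mulrC mulrA.
Qed.

Lemma rat_kernel0 m n (E : 'M[rat]_(m, n)) :
  (forall b : 'rV[int]_m, b^Q *m E = 0 -> b = 0) ->
  forall a : 'rV_m, a *m E = 0 -> a = 0.
Proof.
move=> ker0 a aE; have [k k0 [b kb]] := clear_denominators a.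
have b0 : b = 0 by apply: ker0; rewrite -kb -scalemxAl aE scaler0.
have /eqP := kb; rewrite b0 map_mx0 scaler_eq0 intr_eq0 (negPf k0).
by move/eqP.
Qed.

Section Constant.
Variables (gT : finGroupType) (M : zgmodule gT).
Implicit Types (B : M -> M -> rat) (H : {group gT}).

Lemma zbasis_zfree (L : set M) n (e : 'I_n -> M) :
  zsubgroup L -> zbasis L e <-> zfree_basis L e.
Proof.
move=> [L0 _].
have lcE (c : {ffun 'I_n -> int}) : \sum_i e i *~ c i = lincomb e (\row_i c i).
  by apply: eq_bigr => i _; rewrite mxE.
have lcF (c : 'rV_n) : lincomb e c = \sum_i e i *~ [ffun i => c 0 i] i.
  by apply: eq_bigr => i _; rewrite ffunE.
split=> [[Le sp]|be]; last first.
  have [Le sp fr] := be; split=> // x /sp[c ->].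
  exists [ffun i => c 0 i]; split; first by rewrite lcF.
  move=> d; rewrite lcE => /(zfree_inj be) ->.
  by apply/ffunP => i; rewrite ffunE mxE.
split=> // [x /sp[c [-> _]]|c c0]; first by exists (\row_i c i).
have [d [_ ud]] := sp 0 L0.
have d1 : d = [ffun i => c 0 i] by apply: ud; rewrite -lcF.
have d2 : d = [ffun => 0].
  by apply: ud; rewrite big1 // => i _; rewrite ffunE.
by apply/rowP => i; move: d1; rewrite d2 => /ffunP/(_ i); rewrite !ffunE !mxE.
Qed.

Lemma act0 g : zg_act g (0 : M) = 0.
Proof. exact: (zmap0 (zg_actB g)). Qed.

Lemma zg_fixed_zsubgroup H : zsubgroup (invariants M H).
Proof.
split=> [h _|x y fx fy h hH]; first exact: act0.
by rewrite zg_actB fx // fy.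
Qed.

Lemma gram_detE B (L : set M) n (e : 'I_n -> M) :
  biadditive B -> zsubgroup L -> zfree_basis L e -> gram_det B L = gram B e.
Proof.
move=> bB Lg be; apply: xget_unique.
  by exists n, e; split=> //; apply/(zbasis_zfree _ Lg).
move=> d [m [f [/(zbasis_zfree _ Lg) bf ->]]].
exact: gram_basis_indep bB bf be.
Qed.

Lemma pairing_biadditive B : zg_pairing B -> biadditive B.
Proof. by case. Qed.

(** Averaging over the group the standard form of a basis gives a positive
    definite invariant form. *)
Lemma pairing_exists n (e : 'I_n -> M) :
  zfree_basis setT e -> exists B : M -> M -> rat, zg_pairing B.
Proof.
move=> be; have [_ sp _] := be.
have /choice[c cP] x : exists c, x = lincomb e c by apply: sp.
have cB x y : c (x - y) = c x - c y.
  by apply: (zfree_inj be); rewrite lincombB -!cP.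
pose B x y : rat := \sum_g \sum_i
  (c (zg_act g x) 0 i)%:~R * (c (zg_act g y) 0 i)%:~R.
have BC x y : B x y = B y x.
  by apply: eq_bigr => g _; apply: eq_bigr => i _; rewrite mulrC.
have Bl x y v : B (x - y) v = B x v - B y v.
  rewrite -sumrB; apply: eq_bigr => g _; rewrite -sumrB; apply: eq_bigr => i _.
  by rewrite zg_actB cB !mxE rmorphB /= mulrBl.
have Bx x : B x x = 0 -> x = 0.
  move=> B0; rewrite (cP x); have -> : c x = 0; last exact: lincomb0.
  apply/rowP => i; rewrite mxE; apply/eqP.
  have ge0 g j : 0 <= (c (zg_act g x) 0 j)%:~R * (c (zg_act g x) 0 j)%:~R :> rat.
    by rewrite -expr2 sqr_ge0.
  have := psumr_eq0P (fun g _ => sumr_ge0 _ (fun j _ => ge0 g j)) B0 => /(_ 1%g isT).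
  move/(psumr_eq0P (fun j _ => ge0 1%g j))/(_ i isT)/eqP.
  by rewrite zg_act1 mulf_eq0 orbb intr_eq0.
exists B; split.
- by split=> // x y v; rewrite ![B x _]BC Bl.
- move=> h x y; rewrite [RHS](reindex_inj (mulIg h)) /=.
  by apply: eq_bigr => g _; apply: eq_bigr => i _; rewrite !zg_actM.
- by split=> [x /(_ x)|y /(_ y)]; apply: Bx.
Qed.

(** The restriction of the pairing to the invariants stays non-degenerate,
    because pairing an invariant with [y] is, up to the order of the group,
    pairing it with the trace of [y]. *)
Lemma gram_fixed_neq0 B H n (e : 'I_n -> M) :
  zg_pairing B -> zfree_basis (invariants M H) e -> gram B e != 0.
Proof.
move=> pB be; have bB := pairing_biadditive pB; have [_ Binv [Bnd _]] := pB.
have [Le sp fr] := be.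
apply/negP => /det0P[v v0 vG]; case/eqP: v0.
apply: rat_kernel0 vG => c cG; apply: fr.
pose x := lincomb e c.
have fx : invariants M H x.
  exact: zsubgroup_lincomb (zg_fixed_zsubgroup H) Le.
have xe j : B x (e j) = 0.
  rewrite lincombE_l //; transitivity ((c^Q *m crossgram B e e) 0 j).
    by rewrite mxE; apply: eq_bigr => i _; rewrite !mxE.
  by rewrite cG mxE.
have xf y : invariants M H y -> B x y = 0.
  by move=> /sp[d ->]; rewrite lincombE_r // big1 // => i _; rewrite xe mul0r.
apply: Bnd => y; pose t := \sum_(h in H) zg_act h y.
have ft : invariants M H t.
  move=> g gH; rewrite (zmap_sum (zg_actB g)) /= /t.
  rewrite [RHS](reindex_inj (mulgI g)) /=.
  rewrite big_mkcond [RHS]big_mkcond /=; apply: eq_bigr => h _.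
  by rewrite groupMl // zg_actM; case: (h \in H) => //; rewrite act0.
have : B x t = #|H|%:R * B x y.
  rewrite (zmap_sum (f := B x)); last by case: bB.
  transitivity (\sum_(h in H) B x y); last by rewrite sumr_const mulr_natl.
  by apply: eq_bigr => h hH; rewrite -[in LHS](fx h hH) Binv.
rewrite xf // => /esym/eqP; rewrite mulf_eq0 pnatr_eq0.
by rewrite -[#|H| == 0%N]negbK -lt0n cardG_gt0 => /eqP.
Qed.

Lemma dokchitser_eq (p : nat) (s w : gT) n (e : 'I_n -> M)
    a (es : 'I_a -> M) b (ew : 'I_b -> M) d (eG : 'I_d -> M) (v : rat) :
  #[s]%g = 2 -> #[w]%g = p -> #|[set: gT]| = (2 * p)%N ->
  zfree_basis setT e -> zfree_basis (invariants M <[s]>%G) es ->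
  zfree_basis (invariants M <[w]>%G) ew -> zfree_basis (invariants M [set: gT]%G) eG ->
  (forall B, zg_pairing B ->
     gram B e * (2%:R^-1 ^+ a * gram B es) ^- 2 * (p%:R^-1 ^+ b * gram B ew)^-1 *
       ((2 * p)%:R^-1 ^+ d * gram B eG) ^+ 2 = v) ->
  dokchitser M (Theta_dihedral s w) = v.
Proof.
move=> os ow oG be bes bew beG Bv.
have scaled B c : biadditive B -> biadditive (fun x y => c * B x y).
  by move=> [Bl Br]; split=> x y t; rewrite ?Bl ?Br mulrBr.
have val B : zg_pairing B -> \prod_(t <- Theta_dihedral s w)
    gram_det (fun x y => #|t.1|%:R^-1 * B x y) (invariants M t.1) ^ t.2 = v.
  move=> pB; have bB := pairing_biadditive pB.
  rewrite /Theta_dihedral !big_cons big_nil /= mulr1 -(Bv B pB).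
  have bT : zfree_basis (invariants M 1%G) e.
    apply: eq_zfree be => // x; split=> // _ h.
    by rewrite inE => /eqP->; rewrite zg_act1.
  rewrite (gram_detE (scaled B _ bB) (zg_fixed_zsubgroup _) bT).
  rewrite (gram_detE (scaled B _ bB) (zg_fixed_zsubgroup _) bes).
  rewrite (gram_detE (scaled B _ bB) (zg_fixed_zsubgroup _) bew).
  rewrite (gram_detE (scaled B _ bB) (zg_fixed_zsubgroup _) beG).
  rewrite !gram_scale cards1 invr1 expr1n mul1r oG -!orderE os ow.
  by rewrite !mulrA.
apply: xget_unique; last by move=> c [B pB ->]; apply: val.
have [B pB] := pairing_exists be.
by exists B; rewrite ?val.
Qed.
End Constant.

(** * Dihedral actions *)

Section Dihedral.
Variables (p : nat) (gT : finGroupType) (s w : gT).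
Hypotheses (p_pr : prime p) (p_odd : odd p) (dih : dihedral_gens p s w).

Lemma order_s : #[s]%g = 2.
Proof.
apply: nt_prime_order => //; first exact: dih_s dih.
by apply: contraNneq (dih_notin p_pr dih) => s1; rewrite s1 group1.
Qed.

Lemma card_dihG : #|[set: gT]| = (2 * p)%N.
Proof. by rewrite cardsT (dih_card p_pr dih) mul2n. Qed.

Lemma dih_elim (P : gT -> Prop) :
  P 1%g -> P s -> P w -> (forall g h, P g -> P h -> P (g * h)%g) ->
  forall g, P g.
Proof.
move=> P1 Ps Pw PM g; have [f _ fK] := dih_word_bij p_pr dih.
rewrite -(fK g) /dih_word; apply: (PM); last by case: (f g).2; rewrite ?expg0 ?expg1.
by elim: (nat_of_ord _) => [|k IH]; rewrite ?expg0 // expgS; apply: PM.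
Qed.

Section Module.
Variable M : zgmodule gT.
Implicit Types x y : M.

Lemma actV g x y : zg_act g x = y -> zg_act g^-1%g y = x.
Proof. by move=> <-; rewrite -zg_actM mulVg zg_act1. Qed.

Lemma actVK g x : zg_act g^-1%g (zg_act g x) = x.
Proof. exact: actV. Qed.

Lemma actKV g x : zg_act g (zg_act g^-1%g x) = x.
Proof. by rewrite -zg_actM mulgV zg_act1. Qed.

Lemma act_ss x : zg_act s (zg_act s x) = x.
Proof. by rewrite -zg_actM -expg2 (dih_s dih) zg_act1. Qed.

Lemma act_sw x : zg_act s (zg_act w x) = zg_act w^-1%g (zg_act s x).
Proof. by rewrite -!zg_actM -[w in LHS]expg1 (dih_conj dih) expg1. Qed.

Lemma act_ws x : zg_act w (zg_act s x) = zg_act s (zg_act w^-1%g x).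
Proof. by rewrite -[RHS](actKV w) -act_sw actKV. Qed.

Lemma fixed_cycleP g x : invariants M <[g]>%G x <-> zg_act g x = x.
Proof.
split=> [-> //|gx h]; first exact: cycle_id.
case/cycleP => k ->; elim: k => [|k IH]; first by rewrite zg_act1.
by rewrite expgS zg_actM IH.
Qed.

Lemma fixed_dihP x :
  invariants M [set: gT]%G x <-> zg_act s x = x /\ zg_act w x = x.
Proof.
split=> [fx|[sx wx] h _]; first by split; apply: fx; rewrite inE.
apply: (dih_elim (P := fun h => zg_act h x = x)) => // [|g {}h gx hx].
  exact: zg_act1.
by rewrite zg_actM hx.
Qed.

Lemma fixed_w_act g x : zg_act w x = x -> zg_act w (zg_act g x) = zg_act g x.
Proof.
move: g x; apply: dih_elim => [x|x wx|x wx|g h Pg Ph x wx].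
- by rewrite zg_act1.
- by rewrite act_ws (actV wx).
- by rewrite wx.
- by rewrite zg_actM; apply/Pg/Ph.
Qed.

Definition wnorm x : M := \sum_(h in <[w]>%g) zg_act h x.

Lemma wnorm_fixed x : zg_act w (wnorm x) = wnorm x.
Proof.
rewrite (zmap_sum (zg_actB w)) [RHS](reindex_inj (mulgI w)) /=.
rewrite big_mkcond [RHS]big_mkcond /=; apply: eq_bigr => h _.
by rewrite groupMl ?cycle_id // zg_actM.
Qed.

Lemma wnorm_s x : zg_act s (wnorm x) = wnorm (zg_act s x).
Proof.
rewrite (zmap_sum (zg_actB s)) [RHS](reindex_inj invg_inj) /=.
rewrite big_mkcond [RHS]big_mkcond /=; apply: eq_bigr => h _.
rewrite groupV; case: ifP => // /cycleP[k ->].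
by rewrite -!zg_actM (dih_conj dih).
Qed.

Lemma wnormB x y : wnorm (x - y) = wnorm x - wnorm y.
Proof. by rewrite -sumrB; apply: eq_bigr => h _; rewrite zg_actB. Qed.

Lemma wnorm_of_fixed x : zg_act w x = x -> wnorm x = x *+ p.
Proof.
move/fixed_cycleP => fx; rewrite /wnorm (eq_bigr (fun=> x)) => [|h /fx //].
by rewrite sumr_const -orderE (dih_order p_pr dih).
Qed.

Lemma pairing_wnorm B x y : biadditive B ->
  (forall g x y, B (zg_act g x) (zg_act g y) = B x y) ->
  zg_act w y = y -> p%:R * B x y = B (wnorm x) y.
Proof.
move=> [Bl _] Binv /fixed_cycleP fy.
rewrite (zmap_sum (f := B^~ y)) //.
rewrite (eq_bigr (fun=> B x y)) => [|h hH]; last by rewrite -{1}(fy h hH) Binv.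
by rewrite sumr_const -orderE (dih_order p_pr dih) mulr_natl.
Qed.
End Module.

Lemma wnorm_hom (M N : zgmodule gT) (f : M -> N) x :
  zg_hom f -> f (wnorm x) = wnorm (f x).
Proof.
by move=> [fB fa]; rewrite (zmap_sum fB); apply: eq_bigr => h _.
Qed.

(** * The constant of an extension of a module fixed by the rotations *)

(** The family [famcat x y] has a block diagonal Gram matrix, and its transition
    matrix from [famcat x m] is block triangular with diagonal blocks 1 and
    [D]. *)
Lemma gram_orth_extension (V : zmodType) (B : V -> V -> rat) (K : set V) n k
    (x : 'I_n -> V) (m y : 'I_k -> V) (D : 'M_k) :
  biadditive B -> zfree_basis K x -> (forall i, K (y i - fammul D m i)) ->
  (forall i j, B (x i) (y j) = 0) ->
  (\det D)%:~R ^+ 2 * gram B (famcat x m) = gram B x * gram B y.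
Proof.
move=> bB bx Ky xy; have [E yE] := zfree_coord bx Ky.
rewrite -gram_cat_orth //.
have -> : \det D = \det (block_mx 1%:M 0 E D) by rewrite det_lblock det1 mul1r.
rewrite -gram_fammul //; apply: eq_gram => i; rewrite /fammul.
rewrite -(splitK i); case: (split i) => j /=.
  rewrite famcat_l /block_mx rowKu row_row_mx row0 lincomb_cat lincomb0 addr0.
  by rewrite row1 lincomb_delta.
rewrite famcat_r /block_mx rowKd row_row_mx lincomb_cat.
by rewrite -/(fammul E x j) -yE subrK.
Qed.

End Dihedral.

Section ExtensionFormula.
Variables (p : nat) (gT : finGroupType) (s w : gT).
Hypotheses (p_pr : prime p) (p_odd : odd p) (dih : dihedral_gens p s w).
Variables (M Y : zgmodule gT) (q : M -> Y).
Hypotheses (q_hom : zg_hom q) (q_surj : forall y, exists m, q m = y).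
Hypothesis Y_fixed : forall y : Y, zg_act w y = y.
Hypothesis ker_fixed : forall m, q m = 0 -> zg_act w m = m -> m = 0.

Lemma ker_wnorm m : q m = 0 -> wnorm w m = 0.
Proof.
move=> qm; apply: ker_fixed; last exact: wnorm_fixed.
rewrite wnorm_hom // qm; exact: (zmap0 (@wnormB _ w Y)).
Qed.

Definition lift_image : set Y := [set y | exists2 m, zg_act w m = m & q m = y]%classic.

Lemma lift_unique m m' :
  zg_act w m = m -> zg_act w m' = m' -> q m = q m' -> m = m'.
Proof.
move=> wm wm' qm; apply/subr0_eq/ker_fixed; last by rewrite zg_actB wm wm'.
by rewrite q_hom.1 qm subrr.
Qed.

Lemma lift_image_p y : lift_image (y *+ p).
Proof.
have [m <-] := q_surj y; exists (wnorm w m); first exact: wnorm_fixed.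
by rewrite wnorm_hom // (wnorm_of_fixed p_pr dih).
Qed.

Lemma lift_image_zsubgroup : zsubgroup lift_image.
Proof.
split; first by exists 0; [exact: act0 | exact: (zmap0 q_hom.1)].
move=> _ _ [m wm <-] [m' wm' <-]; exists (m - m').
  by rewrite zg_actB wm wm'.
exact: q_hom.1.
Qed.

Lemma lift_image_s y : lift_image y -> lift_image (zg_act s y).
Proof.
move=> [m wm <-]; exists (zg_act s m); last by rewrite q_hom.2.
exact: (fixed_w_act p_pr dih).
Qed.

(** As invariant lifts are unique, choosing them is additive and equivariant. *)
Lemma lift_image_splits : (forall y, lift_image y) -> splits q.
Proof.
move=> lY; have /choice[r rP] y : exists m, zg_act w m = m /\ q m = y.
  by have [m] := lY y; exists m.
exists r; split; last by move=> y; have [] := rP y.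
split=> [x y|g x]; apply: lift_unique.
- by have [] := rP (x - y).
- by rewrite zg_actB (rP x).1 (rP y).1.
- by rewrite q_hom.1 !(rP _).2.
- by have [] := rP (zg_act g x).
- exact: (fixed_w_act p_pr dih _ (rP x).1).
- by rewrite q_hom.2 !(rP _).2.
Qed.

(** Summing a lift of [y] over the conjugates under [s] gives an invariant lift
    of [2 y], and summing it over the rotations gives one of [p y]; as [p] is
    odd, [y] is a combination of the two. *)
Lemma lift_s_fixed y : zg_act s y = y -> exists2 m, zg_act s m = m & q m = y.
Proof.
move=> sy; have [m qm] := q_surj y.
have sN : zg_act s (wnorm w m) = wnorm w m.
  rewrite (wnorm_s dih) -[zg_act s m](subrK m) (zmapD (@wnormB _ w M)) ker_wnorm ?add0r //.
  by rewrite q_hom.1 q_hom.2 qm sy subrr.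
exists (wnorm w m - (m + zg_act s m) *+ p./2).
  rewrite zg_actB sN (zmapMn (zg_actB s)) (zmapD (zg_actB s)) (act_ss dih).
  by rewrite [_ + m]addrC.
rewrite q_hom.1 wnorm_hom // (wnorm_of_fixed p_pr dih) //.
rewrite (zmapMn q_hom.1) (zmapD q_hom.1) q_hom.2 qm sy -mulr2n -mulrnA.
by rewrite mul2n -{1}(odd_double_half p) p_odd mulrnDr addrK.
Qed.

(** The matrices [D] and [D'] relate bases of [Y] and [Y^s] to bases of the parts
    that lift, so that the absolute values of their determinants are the indices
    of these parts. An invariant under the rotations is orthogonal to the kernel
    of [q], because pairing it with [m] is, up to a factor [p], pairing it with
    the norm of [m]. *)
Theorem dokchitser_extension n (x : 'I_n -> M) h (xs : 'I_h -> M) (k : rat)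
    r (eY : 'I_r -> Y) a (eS : 'I_a -> Y) (D : 'M_r) (D' : 'M_a) :
  zfree_basis [set m | q m = 0]%classic x ->
  zfree_basis [set m | q m = 0 /\ zg_act s m = m]%classic xs ->
  (forall B, biadditive B ->
     (forall g (u v : M), B (zg_act g u) (zg_act g v) = B u v) ->
     gram B x = k * (2%:R^-1 ^+ h * gram B xs) ^+ 2) ->
  zfree_basis setT eY -> zfree_basis [set y | zg_act s y = y]%classic eS ->
  zfree_basis lift_image (fammul D eY) ->
  zfree_basis [set y | lift_image y /\ zg_act s y = y]%classic (fammul D' eS) ->
  dokchitser M (Theta_dihedral s w) =
    k * (\det D')%:~R ^+ 4 / (\det D)%:~R ^+ 2 * p%:R ^+ r / p%:R ^+ (2 * a).
Proof.
move=> bx bxs Bk beY beS bD bD'.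
have [qB qa] := q_hom.
have /choice[m mP] i : exists m, q m = eY i by apply: q_surj.
have /choice[ms msP] i : exists m, zg_act s m = m /\ q m = eS i.
  have [+ _ _] := beS => /(_ i)/lift_s_fixed[u su qu].
  by exists u.
have /choice[y yP] i : exists m, zg_act w m = m /\ q m = fammul D eY i.
  by have [/(_ i)[u wu qu] _ _] := bD; exists u.
have /choice[ys ysP] i :
    exists m, [/\ zg_act s m = m, zg_act w m = m & q m = fammul D' eS i].
  have [/(_ i)[[u wu qu] su] _ _] := bD'; exists u; split=> //.
  apply: lift_unique => //; first exact: (fixed_w_act p_pr dih).
  by rewrite qa qu.
have beM : zfree_basis setT (famcat x m).
  apply: (zfree_extension qB (LW := setT) _ _ _ _ bx) => //.
    by move=> v; split=> [|[]].
  by apply: eq_zfree beY => // i; rewrite /= mP.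
have bes : zfree_basis (invariants M <[s]>%G) (famcat xs ms).
  apply: (zfree_extension qB _ _ _ _ bxs (LW := [set y | zg_act s y = y]%classic)).
  - exact: zg_fixed_zsubgroup.
  - by move=> v; rewrite fixed_cycleP; split=> [[]|[]].
  - by move=> v /fixed_cycleP sv /=; rewrite -qa sv.
  - by move=> i; apply/fixed_cycleP; case: (msP i).
  - by apply: eq_zfree beS => // i; case: (msP i) => _ /= ->.
have bew : zfree_basis (invariants M <[w]>%G) y.
  apply: (zfree_iso qB (LW := lift_image)).
  - exact: zg_fixed_zsubgroup.
  - by move=> v /fixed_cycleP wv qv; apply: ker_fixed.
  - by move=> v /fixed_cycleP wv; exists v.
  - by move=> i; apply/fixed_cycleP; case: (yP i).
  - by apply: eq_zfree bD => // i; case: (yP i) => _ /= ->.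
have beG : zfree_basis (invariants M [set: gT]%G) ys.
  apply: (zfree_iso qB (LW := [set y | lift_image y /\ zg_act s y = y]%classic)).
  - exact: zg_fixed_zsubgroup.
  - by move=> v /(fixed_dihP p_pr dih)[_ wv] qv; apply: ker_fixed.
  - move=> v /(fixed_dihP p_pr dih)[sv wv]; split; first by exists v.
    by rewrite -qa sv.
  - by move=> i; apply/(fixed_dihP p_pr dih); case: (ysP i).
  - by apply: eq_zfree bD' => // i; case: (ysP i) => _ _ /= ->.
apply: (dokchitser_eq (order_s p_pr dih) (dih_order p_pr dih)
  (card_dihG p_pr dih) beM bes bew beG) => B pB.
have bB := pairing_biadditive pB; have [_ Binv _] := pB.
have p0 : p%:R != 0 :> rat by rewrite pnatr_eq0 -lt0n prime_gt0.
have orth u v : q u = 0 -> zg_act w v = v -> B u v = 0.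
  move=> qu wv; apply/eqP; have /eqP := pairing_wnorm p_pr dih u bB Binv wv.
  by rewrite ker_wnorm // (zmap0 (f := B^~ v)) ?mulf_eq0 ?(negPf p0) //; case: bB.
have E1 : (\det D)%:~R ^+ 2 * gram B (famcat x m) = gram B x * gram B y.
  apply: (gram_orth_extension bB bx) => [i|i j] /=.
    by rewrite qB (zmap_lincomb qB) (yP i).2 (eq_lincomb _ mP) subrr.
  by apply: orth; [have [/(_ i)] := bx | case: (yP j)].
have E2 : (\det D')%:~R ^+ 2 * gram B (famcat xs ms) = gram B xs * gram B ys.
  apply: (gram_orth_extension bB bxs) => [i|i j] /=.
    have [sy wy qy] := ysP i; split.
      rewrite qB (zmap_lincomb qB) qy.
      by rewrite (eq_lincomb (f := eS)) ?subrr // => l; case: (msP l).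
    rewrite zg_actB sy (zmap_lincomb (zg_actB s)).
    by rewrite (eq_lincomb (f := ms)) // => l; case: (msP l).
  by apply: orth; [have [/(_ i)[]] := bxs | case: (ysP j)].
have Ek := Bk B bB Binv.
have ny := gram_fixed_neq0 pB bew; have nys := gram_fixed_neq0 pB beG.
have ns := gram_fixed_neq0 pB bes.
have nM : gram B (famcat x m) != 0.
  apply: (gram_fixed_neq0 (H := 1%G) pB); apply: eq_zfree beM => // u.
  by split=> // _ g; rewrite inE => /eqP->; rewrite zg_act1.
(* [D] and [D'] are invertible, since they relate bases of lattices of the
   same rank *)
have det_neq0 c (C : 'M[int]_c) (V : zmodType) (L L' : set V) (e : 'I_c -> V) :
    zfree_basis L e -> zfree_basis L' (fammul C e) -> (\det C)%:~R != 0 :> rat.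
  move=> [_ _ fre] [_ _ frC]; rewrite -det_map_mx.
  apply/negP => /det0P[v v0 vC]; case/eqP: v0; apply: rat_kernel0 vC => b.
  rewrite -map_mxM => /rowP bC; apply: frC; rewrite lincomb_fammul.
  have -> : b *m C = 0; last exact: lincomb0.
  apply/rowP => i; apply: (@intr_inj rat).
  by move: (bC i); rewrite mxE => ->; rewrite !mxE.
have nD := det_neq0 _ _ _ _ _ _ beY bD.
have nD' := det_neq0 _ _ _ _ _ _ beS bD'.
have nx : gram B x != 0.
  have /eqP := E1; apply: contraTneq => ->.
  by rewrite mul0r mulf_neq0 // expf_neq0.
have nxs : gram B xs != 0.
  have /eqP := E2; apply: contraTneq => ->.
  by rewrite mul0r mulf_neq0 // expf_neq0.
have q0 c : (p%:R : rat) ^+ c != 0 by rewrite expf_neq0.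
have -> : gram B (famcat x m) = gram B x * gram B y / (\det D)%:~R ^+ 2.
  by rewrite -E1 mulrC mulKf // expf_neq0.
have -> : gram B (famcat xs ms) = gram B xs * gram B ys / (\det D')%:~R ^+ 2.
  by rewrite -E2 mulrC mulKf // expf_neq0.
rewrite Ek exprD natrM [(2%:R * p%:R)^-1]invfM [(2 * a)%N]mulnC exprM.
rewrite [((2%:R)^-1 * (p%:R)^-1) ^+ a]exprMn !exprVn.
move: nD nD' ny nys nxs (q0 r) (q0 a) (expf_neq0 h (isT : 2%:R != 0 :> rat)).
move: (expf_neq0 a (isT : 2%:R != 0 :> rat)).
move: (gram B y) (gram B ys) (gram B xs) (\det D)%:~R (\det D')%:~R.
move: (2%:R ^+ h) (2%:R ^+ a) (p%:R ^+ r) (p%:R ^+ a).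
move=> t u v z gy gs gx d d' *; field.
by do ?[apply/andP; split].
Qed.
End ExtensionFormula.

(** * Lattices on which the rotations have no invariants *)

Lemma row_double0 n (c : 'rV[int]_n) : c = - c -> c = 0.
Proof.
move=> cc; apply/rowP => i; move/rowP/(_ i): cc; rewrite !mxE => ci.
by move: (c 0 i) ci => t; lia.
Qed.

Section CyclotomicLattice.
Variables (p : nat) (gT : finGroupType) (s w : gT).
Hypotheses (p_pr : prime p) (dih : dihedral_gens p s w).
Variable M : zgmodule gT.
Local Notation S := (zg_act (z := M) s).
Local Notation W := (zg_act (z := M) w).
Local Notation W' := (zg_act (z := M) w^-1%g).

(** The element [w + w^-1] of the group ring commutes with [s], so that it can
    act on the span of a family of eigenvectors of [s]. *)
Definition rotation_trace h (y : 'I_h -> M) (T : 'M[int]_h) :=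
  forall i, W (y i) + W' (y i) = fammul T y i.

Lemma rotation_trace_lincomb h (y : 'I_h -> M) T c :
  rotation_trace y T ->
  W (lincomb y c) + W' (lincomb y c) = lincomb y (c *m T).
Proof.
move=> yT; rewrite -lincomb_fammul !(zmap_lincomb (zg_actB _)).
rewrite /lincomb -big_split; apply: eq_bigr => i _ /=.
by rewrite -yT mulrzDl.
Qed.

Lemma det_unitriangular_pair (h : nat) (T : 'M[rat]_h) :
  \det (block_mx 1%:M (2%:R^-1 *: T) (2%:R^-1 *: T) 1%:M) =
  2%:R^-1 ^+ (2 * h) * \det (4%:R%:M - T *m T).
Proof.
transitivity (\det (block_mx 1%:M 0 (- (2%:R^-1 *: T)) 1%:M *m
    block_mx 1%:M (2%:R^-1 *: T) (2%:R^-1 *: T) 1%:M)).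
  by rewrite det_mulmx det_lblock !det1 !mul1r.
rewrite mulmx_block !mul1mx !mul0mx !addr0 mulmx1 addNr.
rewrite det_ublock det1 mul1r exprM -detZ; congr (\det _).
rewrite mulNmx -scalemxAl -scalemxAr scalerA scalerBr addrC -expr2 scale_scalar_mx.
by congr (_ - _); congr (_%:M); rewrite -[4%:R]/(2%:R * 2%:R) ; field.
Qed.

(** If the reflection fixes [y], then invariance forces
    [B (w y) y' = B (w^-1 y) y'], half of [B (T y) y']. *)
Lemma gram_rotation B h (y : 'I_h -> M) T :
  biadditive B -> (forall g (u v : M), B (zg_act g u) (zg_act g v) = B u v) ->
  (forall i, S (y i) = y i) -> rotation_trace y T ->
  gram B (famcat (W \o y) y) =
    (\det (4%:R%:M - T *m T))%:~R * (2%:R^-1 ^+ h * gram B y) ^+ 2.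
Proof.
move=> bB Binv sy yT; have [Bl Br] := bB.
have half i j : B (W (y i)) (y j) = B (W' (y i)) (y j).
  by rewrite -(Binv s) (act_sw dih) !sy.
have BT i j : B (W (y i)) (y j) = 2%:R^-1 * B (fammul T y i) (y j).
  rewrite -yT (zmapD (f := B^~ (y j))) // -half -mulr2n.
  by rewrite -[X in _ * X]mulr_natl mulKf.
have ST : crossgram B (fammul T y) y = T^Q *m crossgram B y y.
  apply/matrixP => i j; rewrite !mxE lincombE_l //; apply: eq_bigr => k _.
  by rewrite !mxE.
rewrite /gram crossgram_cat.
have -> : crossgram B (W \o y) (W \o y) = crossgram B y y.
  by apply/matrixP => i j; rewrite !mxE Binv.
have E1 : crossgram B (W \o y) y = (2%:R^-1 *: T^Q) *m crossgram B y y.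
  by rewrite -scalemxAl -ST; apply/matrixP => i j; rewrite !mxE BT.
have E2 : crossgram B y (W \o y) = (2%:R^-1 *: T^Q) *m crossgram B y y.
  rewrite -E1; apply/matrixP => i j; rewrite !mxE half.
  by rewrite -[RHS](Binv w) (actKV w).
rewrite E1 E2 -[X in block_mx X _ _ _]mul1mx -[X in block_mx _ _ _ X]mul1mx.
set G := crossgram B y y; pose G2 := block_mx G 0 0 G.
transitivity (\det (block_mx 1%:M (2%:R^-1 *: T^Q) (2%:R^-1 *: T^Q) 1%:M *m G2)).
  by rewrite mulmx_block !mulmx0 !addr0 !add0r.
rewrite det_mulmx det_unitriangular_pair det_lblock -det_map_mx map_mxB map_mxM.
by rewrite map_scalar_mx /= mulnC exprM; ring.
Qed.

Variables (X : set M) (r1 r2 : nat) (x1 : 'I_r1 -> M) (x2 : 'I_r2 -> M).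
Variables (T1 : 'M[int]_r1) (T2 T2' : 'M[int]_r2).

(** [x1] and [x2] span [O]-lattices of the two types: on an ideal generated by
    real elements, and on its twist by a purely imaginary element. *)
Record cyclotomic_lattice : Prop := CyclotomicLattice {
  cyc_zsubgroup : zsubgroup X;
  cyc_basis : zfree_basis X (famcat (W \o famcat x1 x2) (famcat x1 x2));
  cyc_s1 : forall i, S (x1 i) = x1 i;
  cyc_s2 : forall i, S (x2 i) = - x2 i;
  cyc_T1 : rotation_trace x1 T1;
  cyc_T2 : rotation_trace x2 T2;
  cyc_unit : T2 *m T2' = 1%:M }.

Hypothesis cyc : cyclotomic_lattice.

(** As [s] exchanges [w] and [w^-1], it fixes these vectors. *)
Definition imaginary_shift (i : 'I_r2) : M := W' (x2 i) - W (x2 i).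
Local Notation z := imaginary_shift.

Lemma lincomb4 a1 a2 b1 b2 :
  lincomb (famcat (W \o famcat x1 x2) (famcat x1 x2))
    (row_mx (row_mx a1 a2) (row_mx b1 b2)) =
  W (lincomb x1 a1) + W (lincomb x2 a2) + (lincomb x1 b1 + lincomb x2 b2).
Proof.
by rewrite lincomb_cat lincomb_cat -(zmap_lincomb (zg_actB w)) lincomb_cat
   (zmapD (zg_actB w)).
Qed.

Lemma imaginary_shift_lincomb c :
  lincomb z c = W' (lincomb x2 c) - W (lincomb x2 c).
Proof.
rewrite !(zmap_lincomb (zg_actB _)) /lincomb -sumrB.
by apply: eq_bigr => i _; rewrite mulrzBl.
Qed.

Lemma imaginary_shiftE c :
  lincomb z c = lincomb x2 (c *m T2) - W (lincomb x2 c) *+ 2.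
Proof.
rewrite imaginary_shift_lincomb -(rotation_trace_lincomb _ (cyc_T2 cyc)).
by rewrite mulr2n opprD addrA [W _ + _]addrC addrK.
Qed.

Lemma imaginary_shift_s i : S (z i) = z i.
Proof.
rewrite zg_actB (act_sw dih) -(act_ws dih) (cyc_s2 cyc).
by rewrite !(zmapN (zg_actB _)) opprK addrC.
Qed.

Lemma imaginary_shift_trace : rotation_trace z T2.
Proof.
move=> i; rewrite /fammul imaginary_shift_lincomb -/(fammul T2 x2 i).
rewrite -(cyc_T2 cyc) /imaginary_shift !(zmapD (zg_actB _)).
by rewrite !(zmapN (zg_actB _)) actKV actVK opprD addrACA.
Qed.

Definition fixed_family : 'I_(r1 + r2) -> M := famcat x1 z.

Lemma fixed_family_s i : S (fixed_family i) = fixed_family i.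
Proof.
move: i; apply: (famcatP (P := fun v => S v = v)); first exact: (cyc_s1 cyc).
exact: imaginary_shift_s.
Qed.

Lemma fixed_family_trace : rotation_trace fixed_family (block_mx T1 0 0 T2).
Proof.
move=> i; rewrite -(splitK i) /fammul; case: (split i) => j /=.
  rewrite /fixed_family famcat_l /block_mx rowKu row_row_mx row0 lincomb_cat.
  by rewrite lincomb0 addr0 (cyc_T1 cyc).
rewrite /fixed_family famcat_r /block_mx rowKd row_row_mx row0 lincomb_cat.
by rewrite lincomb0 add0r imaginary_shift_trace.
Qed.

Lemma lincomb_s1 c : S (lincomb x1 c) = lincomb x1 c.
Proof.
rewrite (zmap_lincomb (zg_actB s)); apply: eq_lincomb; exact: (cyc_s1 cyc).
Qed.

Lemma lincomb_s2 c : S (lincomb x2 c) = - lincomb x2 c.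
Proof.
rewrite (zmap_lincomb (zg_actB s)) /lincomb -sumrN; apply: eq_bigr => i _ /=.
by rewrite (cyc_s2 cyc) mulNrz.
Qed.

(** In the coordinates of [x2] and [w x2], a vector fixed by [s] has the form
    [g T2, -2 g]: recovering [g] takes that [T2] is invertible. *)
Lemma fixed_family_basis :
  zfree_basis [set v | X v /\ S v = v]%classic fixed_family.
Proof.
have bas := cyc_basis cyc; have [Xb sp fr] := bas; have Xg := cyc_zsubgroup cyc.
have T2K := mulmx1C (cyc_unit cyc).
split.
- move=> i; split; last exact: fixed_family_s.
  have Xx j : X (famcat x1 x2 j) by have := Xb (rshift _ j); rewrite famcat_r.
  have Xw j : X (W (famcat x1 x2 j)) by have := Xb (lshift _ j); rewrite famcat_l.
  move: i; apply: famcatP => i.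
    by have := Xx (lshift _ i); rewrite famcat_l.
  rewrite -(lincomb_delta z) imaginary_shiftE; apply: Xg.2.
    apply: zsubgroup_lincomb => // j.
    by have := Xx (rshift _ j); rewrite famcat_r.
  have Xwi : X (W (x2 i)) by have := Xw (rshift _ i); rewrite famcat_r.
  rewrite lincomb_delta mulr2n -[X in _ + X]opprK.
  by apply: Xg.2 => //; rewrite -sub0r; apply: Xg.2 => //; case: Xg.
- move=> v [/sp[c]]; rewrite -[c]hsubmxK -[lsubmx c]hsubmxK -[rsubmx c]hsubmxK.
  move: (lsubmx (lsubmx c)) (rsubmx (lsubmx c)) => a1 a2.
  move: (lsubmx (rsubmx c)) (rsubmx (rsubmx c)) => b1 b2.
  move=> vE; rewrite {1}vE lincomb4 !(zmapD (zg_actB s)) !(act_sw dih).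
  rewrite !lincomb_s1 !lincomb_s2 (zmapN (zg_actB _)).
  have Wt1 : W' (lincomb x1 a1) = lincomb x1 (a1 *m T1) - W (lincomb x1 a1).
    by rewrite -(rotation_trace_lincomb _ (cyc_T1 cyc)) addrAC subrr add0r.
  have Wt2 : W' (lincomb x2 a2) = lincomb x2 (a2 *m T2) - W (lincomb x2 a2).
    by rewrite -(rotation_trace_lincomb _ (cyc_T2 cyc)) addrAC subrr add0r.
  have sE : W' (lincomb x1 a1) - W' (lincomb x2 a2) + (lincomb x1 b1 - lincomb x2 b2)
    = lincomb (famcat (W \o famcat x1 x2) (famcat x1 x2))
        (row_mx (row_mx (- a1) a2) (row_mx (a1 *m T1 + b1) (- (a2 *m T2) - b2))).
    rewrite lincomb4 lincombB !lincombN lincombD (zmapN (zg_actB w)) Wt1 Wt2.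
    have shuffle (n1 v1 n2 v2 t1 t2 : M) :
        n1 - v1 - (n2 - v2) + (t1 - t2) = - v1 + v2 + (n1 + t1 + (- n2 - t2)).
      rewrite [n1 - v1]addrC opprB -!addrA; congr (_ + _); rewrite addrCA.
      by congr (_ + (_ + _)); rewrite addrCA.
    exact: shuffle.
  rewrite sE vE => /(zfree_inj bas)/eq_row_mx[/eq_row_mx[a1N _] /eq_row_mx[_ b2E]].
  have a10 : a1 = 0 by apply: row_double0.
  have a2E : a2 *m T2 = - b2 - b2.
    by rewrite -{1}b2E opprB opprK addrAC subrr add0r.
  exists (row_mx b1 (b2 *m T2')); rewrite /fixed_family [RHS]lincomb_cat.
  rewrite imaginary_shiftE lincomb4 a10 lincomb0 act0 add0r addrCA; congr (_ + _).
  rewrite addrC -mulmxA T2K mulmx1; congr (_ + _).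
  have -> : a2 = - (b2 *m T2') - b2 *m T2'.
    by rewrite -[LHS]mulmx1 -(cyc_unit cyc) mulmxA a2E mulmxBl mulNmx.
  by rewrite lincombB zg_actB -[- (_ *m _)]sub0r lincombB lincomb0 sub0r
     (zmapN (zg_actB w)) -opprD -mulr2n.
- move=> c; rewrite -[c]hsubmxK; move: (lsubmx c) (rsubmx c) => b g.
  rewrite lincomb_cat imaginary_shiftE => c0.
  have : lincomb (famcat (W \o famcat x1 x2) (famcat x1 x2))
    (row_mx (row_mx 0 (- g - g)) (row_mx b (g *m T2))) = 0.
    rewrite lincomb4 lincomb0 act0 add0r -c0 lincombB -[- g]sub0r lincombB.
    rewrite lincomb0 sub0r zg_actB (zmapN (zg_actB w)) -opprD -mulr2n.
    by rewrite addrC -addrA.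
  move/fr; rewrite -[X in _ = X]row_mx0 => /eq_row_mx[].
  rewrite -[X in _ = X]row_mx0 => /eq_row_mx[_ gg].
  rewrite -[X in _ = X]row_mx0 => /eq_row_mx[-> _].
  rewrite (_ : g = 0) ?row_mx0 //; apply: row_double0.
  by apply/subr0_eq; rewrite opprK -[LHS]opprK opprD gg oppr0.
Qed.

(** The transition matrix from the basis of [X] to the family formed by
    [fixed_family] and its image under [w]: the rows are those of [w x1],
    [w z = 2 x2 - T2 (w x2)], [x1] and [z = T2 x2 - 2 w x2]. *)
Lemma det_change_basis :
  \det (block_mx (block_mx 1%:M 0 0 (- T2)) (block_mx 0 0 0 2%:R%:M)
                 (block_mx 0 0 0 (- 2%:R%:M)) (block_mx 1%:M 0 0 T2)
         : 'M[int]_((r1 + r2) + (r1 + r2))) = \det (4%:R%:M - T2 *m T2).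
Proof.
have T2K := mulmx1C (cyc_unit cyc).
(* [Q] clears the lower left block, since [T2'] is the inverse of [T2] *)
set P := block_mx _ _ _ _.
pose Q : 'M[int]_((r1 + r2) + (r1 + r2)) :=
  block_mx 1%:M 0 (block_mx 0 0 0 (2%:R *: T2')) 1%:M.
have -> : \det P = \det (P *m Q) by rewrite det_mulmx det_lblock !det1 !mulr1.
rewrite /P /Q mulmx_block !mulmx1 !mulmx0 !add0r !mulmx_block.
rewrite !(mul1mx, mulmx0, mul0mx, addr0, add0r).
rewrite mul_scalar_mx scalerA -scalemxAr (cyc_unit cyc).
rewrite [X in block_mx X _ _ _]add_block_mx [X in block_mx _ _ X _]add_block_mx !addr0.
have -> : - 2%:R%:M + 2%:R *: 1%:M = 0 :> 'M[int]_r2.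
  by rewrite scale_scalar_mx mulr1 addNr.
rewrite block_mx0 det_ublock !det_ublock !det1 !mul1r.
rewrite -det_mulmx mulmxDl mulNmx -scalemxAl T2K addrC.
by rewrite scale_scalar_mx mulr1 -natrM.
Qed.

(** [gram_rotation] applies to [fixed_family], which with its image under [w]
    spans a sublattice of index [det (4 - T2^2)] in [X]. *)
Lemma gram_cyclotomic B :
  biadditive B -> (forall g (u v : M), B (zg_act g u) (zg_act g v) = B u v) ->
  \det (4%:R%:M - T2 *m T2) != 0 ->
  gram B (famcat (W \o famcat x1 x2) (famcat x1 x2)) =
    (\det (4%:R%:M - T1 *m T1))%:~R / (\det (4%:R%:M - T2 *m T2))%:~R *
    (2%:R^-1 ^+ (r1 + r2) * gram B fixed_family) ^+ 2.
Proof.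
move=> bB Binv d2; have := gram_rotation bB Binv fixed_family_s fixed_family_trace.
have -> : \det (4%:R%:M - block_mx T1 0 0 T2 *m block_mx T1 0 0 T2) =
    \det (4%:R%:M - T1 *m T1) * \det (4%:R%:M - T2 *m T2).
  rewrite mulmx_block !(mulmx0, mul0mx, addr0, add0r) scalar_mx_block.
  by rewrite opp_block_mx add_block_mx !oppr0 !addr0 det_ublock.
have row2 j : lincomb x2 (row j 2%:R%:M) = x2 j *+ 2.
  by rewrite -scalemx1 linearZ /= row1 scaler_nat mulr2n lincombD lincomb_delta.
have -> : gram B (famcat (W \o fixed_family) fixed_family) = gram B (fammul
  (block_mx (block_mx 1%:M 0 0 (- T2)) (block_mx 0 0 0 2%:R%:M)
            (block_mx 0 0 0 (- 2%:R%:M)) (block_mx 1%:M 0 0 T2))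
  (famcat (W \o famcat x1 x2) (famcat x1 x2))).
  apply: eq_gram => i; rewrite -(splitK i) /fammul.
  case: (split i) => k /=; rewrite -(splitK k); case: (split k) => j /=.
  - rewrite famcat_l /= /fixed_family famcat_l.
    rewrite /block_mx rowKu row_row_mx !rowKu !row_row_mx !row0 row1.
    by rewrite lincomb4 lincomb_delta !lincomb0 act0 !addr0.
  - rewrite famcat_l /= /fixed_family famcat_r.
    rewrite /block_mx rowKu row_row_mx !rowKd !row_row_mx !row0.
    rewrite lincomb4 !lincomb0 act0 !add0r linearN lincombN -/(fammul T2 x2 j).
    rewrite -(cyc_T2 cyc) row2 zg_actB actKV (zmapN (zg_actB _)).
    by rewrite (zmapD (zg_actB w)) actKV opprD mulr2n -addrA addKr addrC.
  - rewrite famcat_r /fixed_family famcat_l.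
    rewrite /block_mx rowKd row_row_mx !rowKu !row_row_mx !row0 row1.
    by rewrite lincomb4 lincomb_delta !lincomb0 !act0 !addr0 !add0r.
  - rewrite famcat_r /fixed_family famcat_r.
    rewrite /block_mx rowKd row_row_mx !rowKd !row_row_mx !row0.
    rewrite lincomb4 !lincomb0 act0 !add0r linearN lincombN row2.
    rewrite -(lincomb_delta z) imaginary_shiftE lincomb_delta -rowE addrC.
    by rewrite (zmapN (zg_actB w)) (zmapMn (zg_actB w)).
rewrite gram_fammul // det_change_basis rmorphM /= => E.
have d2' : (\det (4%:R%:M - T2 *m T2))%:~R != 0 :> rat by rewrite intr_eq0.
apply: (mulfI (expf_neq0 2 d2')); rewrite E.
by field.
Qed.

End CyclotomicLattice.

(** * Ideals of the real cyclotomic field as lattices *)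

(** A subgroup on which finitely many integer-valued additive maps are jointly
    injective is free: the image of one map is cyclic, and induction treats its
    kernel. *)
Lemma zfree_basis_exists (V : zmodType) n (f : nat -> V -> algC) (L : set V) :
  zsubgroup L -> (forall k x y, f k (x - y) = f k x - f k y) ->
  (forall k x, L x -> f k x \in Num.int) ->
  (forall x, L x -> (forall k, (k < n)%N -> f k x = 0) -> x = 0) ->
  exists r (e : 'I_r -> V), zfree_basis L e.
Proof.
elim: n f L => [|n IH] f L Lg fB fZ inj.
  exists 0, (fun _ => 0); split=> [[]//|x Lx|c _]; last by apply/rowP => -[].
  by exists 0; rewrite lincomb0; apply: inj.
pose K := [set x | L x /\ f 0 x = 0]%classic.
have [||||r [e be]] := IH (fun k => f k.+1) K.
- split; first by split; [case: Lg | exact: (zmap0 (fB 0))].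
  move=> x y [Lx fx] [Ly fy]; split; first by apply: Lg.2.
  by rewrite fB fx fy subrr.
- by move=> k x y; apply: fB.
- by move=> k x [Lx _]; apply: fZ.
- by move=> x [Lx f0] fk; apply: inj => // -[|k] //; apply: fk.
have [LK|/existsNP[x0 /not_implyP[Lx0 fx0]]] := pselect (forall x, L x -> f 0 x = 0).
  exists r, e; apply: eq_zfree be => // x; split=> [[]//|Lx].
  by split=> //; apply: LK.
have fE x : L x -> exists k : int, f 0 x = k%:~R by move/(fZ 0)/intrP.
pose P d := `[< exists2 x, L x &
  exists2 k : int, f 0 x = k%:~R & (0 < d)%N && (absz k == d) >].
have exP : exists d, P d.
  have [k fk] := fE _ Lx0; exists (absz k); apply/asboolP; exists x0 => //.
  exists k => //; rewrite eqxx andbT lt0n absz_eq0.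
  by apply: contra_not_neq fx0 => k0; rewrite fk k0.
have [d /asboolP[y Ly [l fy /andP[d0 /eqP ld]]] dmin] := ex_minnP exP.
have l0 : l != 0 by rewrite -absz_eq0 ld -lt0n.
pose LW : set algC := [set a | exists k : int, a = l%:~R *~ k]%classic.
exists (r + 1)%N, (famcat e (fun _ => y)).
apply: (zfree_extension (fB 0) (LW := LW) Lg _ _ _ be) => //.
  move=> x Lx; have [k fx] := fE _ Lx; exists (k %/ l)%Z.
  have Lym : L (y *~ (k %/ l)%Z) by apply: zsubgroupMz.
  have fm : f 0 (x - y *~ (k %/ l)%Z) = (k %% l)%Z%:~R.
    rewrite fB (zmapMz (fB 0)) fx fy -mulrzA -mulrzBr {1}(divz_eq k l) [l * _]mulrC.
    by rewrite addrAC subrr add0r.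
  have [k0|k1] := eqVneq (k %% l)%Z 0.
    by rewrite fx {1}(divz_eq k l) k0 addr0 -mulrzA mulrC.
  have : P (absz (k %% l)%Z).
    apply/asboolP; exists (x - y *~ (k %/ l)%Z); first by apply: Lg.2.
    by exists (k %% l)%Z => //; rewrite eqxx andbT lt0n absz_eq0.
  move/dmin; rewrite -ld leqNgt -ltz_nat !abszE.
  by rewrite (ger0_norm (modz_ge0 _ l0)) ltz_mod.
split=> [i|a [k ->]|c].
- by exists 1; rewrite mulr1z.
- by exists (\row_i k); rewrite /lincomb big_ord1 mxE /= fy.
- rewrite /lincomb big_ord1 /= fy -mulrzA => /eqP.
  rewrite intr_eq0 mulf_eq0 (negPf l0) /= => /eqP c0.
  by apply/rowP => i; rewrite ord1 c0 mxE.
Qed.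

Section CyclotomicField.
Variables (p : nat) (z : algC).
Hypotheses (p_pr : prime p) (z_prim : p.-primitive_root z).
Local Notation pQtoC := (map_poly (ratr : rat -> algC)).

Lemma cyclo_fieldM x y : cyclo_field z x -> cyclo_field z y -> cyclo_field z (x * y).
Proof. by move=> [q ->] [r ->]; exists (q * r); rewrite rmorphM hornerM. Qed.

Lemma cyclo_fieldX k : cyclo_field z (z ^+ k).
Proof. by exists 'X^k; rewrite map_polyXn hornerXn. Qed.

Lemma cyclo_fieldD x y : cyclo_field z x -> cyclo_field z y -> cyclo_field z (x + y).
Proof. by move=> [q ->] [r ->]; exists (q + r); rewrite rmorphD hornerD. Qed.

Lemma sum_powers_root (x : algC) : x ^+ p = 1 ->
  \sum_(j < p) x ^+ j = if x == 1 then p%:R else 0.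
Proof.
move=> xp; case: eqP => [->|/eqP x1].
  by rewrite (eq_bigr (fun=> 1)) ?sumr_const ?card_ord // => i _; rewrite expr1n.
have /eqP := subrX1 x p; rewrite xp subrr eq_sym mulf_eq0 subr_eq0 (negPf x1).
by move/eqP.
Qed.

Lemma galois_exists (j : nat) :
  exists u : {rmorphism algC -> algC}, (0 < j < p)%N ->
    forall x, x ^+ p = 1 -> u x = x ^+ j.
Proof.
case: (boolP (0 < j < p)%N) => [/andP[j0 jp]|_]; last by exists idfun.
have [|u uE] := @Qn_aut_exists j p; last by exists u.
by rewrite coprime_sym prime_coprime // gtnNdvd.
Qed.

Definition galois : nat -> {rmorphism algC -> algC} := projT1 (choice galois_exists).

Lemma galoisE (j : nat) x : (0 < j < p)%N -> x ^+ p = 1 -> galois j x = x ^+ j.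
Proof. by move=> jp; apply: (projT2 (choice galois_exists) j jp). Qed.

Definition cyclo_trace (x : algC) : algC := \sum_(j < p.-1) galois j.+1 x.

Lemma cyclo_traceB x y : cyclo_trace (x - y) = cyclo_trace x - cyclo_trace y.
Proof. by rewrite /cyclo_trace -sumrB; apply: eq_bigr => j _; rewrite rmorphB. Qed.

Lemma zX_root k : (z ^+ k) ^+ p = 1.
Proof. by rewrite -exprM mulnC exprM (prim_expr_order z_prim) expr1n. Qed.

Lemma bound_prime (j : 'I_p.-1) : (0 < j.+1 < p)%N.
Proof. by have := ltn_ord j; have := prime_gt0 p_pr; lia. Qed.

Lemma cyclo_trace_rat x : cyclo_field z x -> cyclo_trace x \in Crat.
Proof.
move=> [q ->]; rewrite horner_coef (zmap_sum cyclo_traceB).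
apply: rpred_sum => k _; rewrite coef_map.
have -> : cyclo_trace (ratr q`_k * z ^+ k) = ratr q`_k * cyclo_trace (z ^+ k).
  rewrite mulr_sumr; apply: eq_bigr => j _.
  by rewrite rmorphM /= fmorph_rat.
apply: rpredM; first exact: Crat_rat.
have : \sum_(j < p) (z ^+ k) ^+ j \in Crat.
  by rewrite sum_powers_root ?zX_root //; case: ifP => _; rewrite ?rpred_nat ?rpred0.
have recl n (F : nat -> algC) :
    (0 < n)%N -> \sum_(j < n) F j = F 0 + \sum_(j < n.-1) F j.+1.
  by case: n => // n _; rewrite big_ord_recl.
rewrite (recl p (fun j => (z ^+ k) ^+ j)) ?prime_gt0 // expr0.
have -> : cyclo_trace (z ^+ k) = \sum_(j < p.-1) (z ^+ k) ^+ j.+1.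
  by apply: eq_bigr => j _; rewrite galoisE ?zX_root // bound_prime.
by move=> h; rewrite -[X in X \in _](addKr 1) rpredD ?rpredN ?rpred1.
Qed.

Lemma cyclo_trace_int x : cyclo_field z x -> x \in Aint -> cyclo_trace x \in Num.int.
Proof.
move=> fx ax; apply: Cint_rat_Aint; first exact: cyclo_trace_rat.
by apply: rpred_sum => j _; rewrite Aint_aut.
Qed.

(** The traces of [x z^k] are the Fourier coefficients of the family of the
    conjugates of [x]. *)
Lemma cyclo_trace_inj x : (forall k, (k < p)%N -> cyclo_trace (x * z ^+ k) = 0) -> x = 0.
Proof.
move=> x0; have p1 := prime_gt1 p_pr.
have p1' : (0 < p.-1)%N by lia.
have E (j : 'I_p.-1) : \sum_(k < p) z ^+ (p.-1 * k) * galois j.+1 (x * z ^+ k) =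
    galois j.+1 x * (if j == Ordinal p1' then p%:R else 0).
  rewrite (eq_bigr (fun k : 'I_p => galois j.+1 x * (z ^+ (j + p)) ^+ k)).
    have zj : (z ^+ (j + p) == 1) = (j == Ordinal p1').
      rewrite -(prim_order_dvd z_prim) dvdn_addl // -val_eqE /=.
      have [->|j0] := posnP j; first by rewrite dvdn0.
      by rewrite gtnNdvd ?gtn_eqF //; have := ltn_ord j; lia.
    by rewrite -mulr_sumr sum_powers_root ?zX_root // zj.
  move=> k _; rewrite rmorphM /= (galoisE (bound_prime j) (zX_root k)) mulrCA.
  congr (_ * _); rewrite -!exprM -exprD; congr (z ^+ _).
  by rewrite [(k * _)%N]mulnC -mulnDl; congr (_ * _)%N; lia.
have : \sum_(k < p) z ^+ (p.-1 * k) * cyclo_trace (x * z ^+ k) = 0.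
  by rewrite big1 // => k _; rewrite x0 ?mulr0.
rewrite (eq_bigr (fun k : 'I_p => \sum_(j < p.-1)
  z ^+ (p.-1 * k) * galois j.+1 (x * z ^+ k))) => [|k _]; last exact: mulr_sumr.
rewrite exchange_big /= (eq_bigr _ (fun j _ => E j)) (bigD1 (Ordinal p1')) //=.
rewrite big1 => [|j /negPf->]; last by rewrite mulr0.
move/eqP; rewrite addr0 mulf_eq0 pnatr_eq0 [p == 0%N]gtn_eqF ?prime_gt0 // orbF.
by move/eqP=> g0; apply: (fmorph_inj (galois 1)); rewrite g0 rmorph0.
Qed.
End CyclotomicField.

Section CyclotomicIdeal.
Variables (p : nat) (z : algC).
Hypotheses (p_pr : prime p) (p_odd : odd p) (z_prim : p.-primitive_root z).
Local Notation pQtoC := (map_poly (ratr : rat -> algC)).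

(** The cyclotomic polynomial of prime index; in this form its values at 1 and
    -1 are immediate. *)
Definition cyclo_poly : {poly rat} := \poly_(i < p) 1.

Lemma size_cyclo_poly : size cyclo_poly = p.
Proof. by rewrite size_poly_eq ?oner_neq0. Qed.

Lemma cyclo_poly_monic : cyclo_poly \is monic.
Proof. by rewrite monicE lead_coef_poly ?prime_gt0 // oner_neq0. Qed.

Lemma root_cyclo_poly q : root (pQtoC q) z = (cyclo_poly %| q).
Proof.
have [f [fz fm] fP] := minCpolyP z.
have sf : size f = p.
  rewrite -(size_map_poly (ratr : {rmorphism rat -> algC})) -fz.
  rewrite (minCpoly_cyclotomic z_prim) size_cyclotomic totient_prime //.
  by rewrite prednK ?prime_gt0.
suff -> : cyclo_poly = f by apply: fP.
apply/esym/eqP; rewrite -eqp_monic // ?cyclo_poly_monic //.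
rewrite -dvdp_size_eqp ?sf ?size_cyclo_poly // -fP /root /cyclo_poly poly_def.
rewrite rmorph_sum /= horner_sum (eq_bigr (fun i : 'I_p => z ^+ i)) => [|i _]; last first.
  by rewrite scale1r map_polyXn hornerXn.
have z1 : z != 1.
  apply/eqP => z1; have := prim_order_dvd z_prim 1.
  by rewrite z1 expr1n eqxx dvdn1 => /eqP p1; move: p_pr; rewrite p1.
by rewrite sum_powers_root ?(prim_expr_order z_prim) // (negPf z1).
Qed.

Lemma cyclo_field_coord y :
  cyclo_field z y -> exists c : 'rV[rat]_p.-1, y = \sum_i ratr (c 0 i) * z ^+ i.
Proof.
move=> [q ->]; exists (\row_i (q %% cyclo_poly)`_i).
have r0 : (pQtoC cyclo_poly).[z] = 0.
  by apply/eqP; rewrite -/(root _ z) root_cyclo_poly.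
rewrite {1}(divp_eq q cyclo_poly) rmorphD rmorphM /= hornerD hornerM r0 mulr0 add0r.
rewrite (@horner_coef_wide _ p.-1); last first.
  rewrite size_map_poly -ltnS prednK ?prime_gt0 // -[X in (_ < X)%N]size_cyclo_poly.
  by rewrite ltn_modp -size_poly_eq0 size_cyclo_poly -lt0n prime_gt0.
by apply: eq_bigr => i _; rewrite coef_map mxE.
Qed.

(** Clearing denominators, independence over the integers is independence over
    the rational numbers, and the field has dimension [p - 1]. *)
Lemma cyclo_independent_size n (v : 'I_n -> algC) :
  (forall i, cyclo_field z (v i)) -> (forall c, lincomb v c = 0 -> c = 0) ->
  (n <= p.-1)%N.
Proof.
move=> vf vfree; rewrite leqNgt; apply/negP => lt_pn.
have [c vE] := choice (fun i => cyclo_field_coord (vf i)).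
pose E := \matrix_i c i.
have : kermx E != 0.
  by rewrite -mxrank_eq0 mxrank_ker -lt0n subn_gt0 (leq_ltn_trans _ lt_pn) ?rank_leq_col.
case/rowV0Pn => a /sub_kermxP aE; case/eqP; apply: rat_kernel0 aE => b bE0.
apply: vfree; rewrite /lincomb.
under eq_bigr => i _ do rewrite vE -mulrzl mulr_sumr.
rewrite exchange_big /= big1 // => j _.
have : (b^Q *m E) 0 j = 0 by rewrite bE0 mxE.
rewrite mxE => /(congr1 (ratr : rat -> algC)); rewrite rmorph_sum rmorph0 /= => bE.
transitivity (\sum_i ratr (b^Q 0 i * E i j) * z ^+ j).
  by apply: eq_bigr => i _; rewrite rmorphM /= !mxE ratr_int mulrA.
by rewrite -mulr_suml bE mul0r.
Qed.

Lemma det_block_schur (R : comNzRingType) m n (A : 'M[R]_m) (B : 'M_(m, n))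
    (C : 'M_(n, m)) : \det (block_mx A B C 1%:M) = \det (A - B *m C).
Proof.
have -> : block_mx A B C 1%:M =
    block_mx 1%:M B 0 1%:M *m block_mx (A - B *m C) 0 C 1%:M.
  by rewrite mulmx_block !(mul1mx, mulmx1, mul0mx, mulmx0, add0r, addr0) subrK.
by rewrite det_mulmx det_ublock det_lblock !det1 !mul1r mulr1.
Qed.

(** The companion matrix of [X^2 - T X + 1] has [z] as an eigenvalue, with
    eigenvector [v], and size at most [p - 1], so that its characteristic
    polynomial is [cyclo_poly]. By Schur complements its values at 1 and -1 are
    [det (2 - T)] and [det (2 + T)]. *)
Lemma det_cyclo_companion r (T : 'M[int]_r) (v : 'I_(r + r) -> algC) :
  (exists i, v i != 0) -> (r + r <= p.-1)%N ->
  (forall i, z * v i = fammul (block_mx T (- 1%:M) 1%:M 0) v i) ->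
  \det (4%:R%:M - T *m T) = p%:Z.
Proof.
move=> [i0 vi0] le_rp zv.
pose W : 'M[int]_(r + r) := block_mx T (- 1%:M) 1%:M 0.
pose chi : {poly int} := char_poly W^T.
have sz : size chi = (r + r).+1 by rewrite size_char_poly.
pose chiQ : {poly rat} := map_poly intr chi.
have chiQm : chiQ \is monic by apply/monic_map/char_poly_monic.
have szQ : size chiQ = (r + r).+1.
  by rewrite size_map_poly_id0 // (monicP (char_poly_monic _)) rmorph1 oner_neq0.
have rt : root (pQtoC chiQ) z.
  have -> : pQtoC chiQ = char_poly (map_mx intr W^T).
    rewrite -map_char_poly /chiQ -map_poly_comp; apply: eq_map_poly => k /=.
    exact: ratr_int.
  rewrite -eigenvalue_root_char; apply/eigenvalueP.
  exists (\row_i v i); last first.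
    by apply: contraNneq vi0 => /rowP/(_ i0); rewrite !mxE => ->.
  apply/rowP => i; rewrite !mxE zv /fammul /lincomb; apply: eq_bigr => k _.
  by rewrite !mxE mulrzr.
have chiE : chiQ = cyclo_poly.
  rewrite root_cyclo_poly in rt; apply/esym/eqP.
  rewrite -eqp_monic ?cyclo_poly_monic // -dvdp_size_eqp // size_cyclo_poly szQ.
  rewrite eqn_leq -{1}szQ -[X in (X <= _)%N]size_cyclo_poly.
  rewrite dvdp_leq ?monic_neq0 //=.
  by rewrite -[X in (_ <= X)%N](prednK (prime_gt0 p_pr)) ltnS.
have chi_det a : chi.[a] = \det (a%:M - W).
  rewrite -det_tr linearB /= tr_scalar_mx /chi /char_poly -horner_evalE -det_map_mx.
  congr (\det _); apply/matrixP => i j; rewrite !mxE /=.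
  by rewrite /horner_eval !hornerE hornerMn hornerX.
have chi1 : \det (2%:R%:M - T) = p%:Z.
  have : chi.[1] = p%:Z.
    apply: (@intr_inj rat); rewrite -horner_map -/chiQ chiE rmorph1 horner_poly.
    rewrite (eq_bigr (fun=> 1)) ?sumr_const ?card_ord // => i _.
    by rewrite expr1n mul1r.
  rewrite chi_det scalar_mx_block opp_block_mx add_block_mx oppr0 addr0 opprK.
  rewrite add0r sub0r det_block_schur mul1mx opprK addrAC -raddfD /=.
  by move=> <-.
have chiN1 : \det (2%:R%:M + T) = 1.
  have : chi.[-1] = 1.
    apply: (@intr_inj rat); rewrite -horner_map -/chiQ chiE rmorphN rmorph1 horner_poly.
    have nz : -1 - 1 != 0 :> rat by [].
    apply: (mulfI nz); rewrite mulr1 (eq_bigr (fun i : 'I_p => (-1) ^+ i)).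
      by rewrite -subrX1 -signr_odd p_odd expr1.
    by move=> i _; rewrite mul1r.
  rewrite chi_det raddfN -opprD -scaleN1r detZ exprD -expr2 -exprM mulnC exprM.
  rewrite sqrrN !expr1n mul1r /= scalar_mx_block add_block_mx !addr0 !add0r.
  by rewrite det_block_schur mulNmx mulmx1 opprK addrAC -raddfD.
have -> : 4%:R%:M - T *m T = (2%:R%:M - T) *m (2%:R%:M + T).
  rewrite mulmxDl !mulmxDr !mulNmx !mul_scalar_mx mul_mx_scalar scale_scalar_mx.
  by rewrite -natrM addrA addrK.
by rewrite det_mulmx chi1 chiN1 mulr1.
Qed.
End CyclotomicIdeal.

Section RealIdeal.
Variables (p : nat) (z : algC).
Hypotheses (p_pr : prime p) (p_odd : odd p) (z_prim : p.-primitive_root z).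

Definition real_trace : algC := z + z^*.
Local Notation tau := real_trace.

Lemma zsquare : z * z = tau * z - 1.
Proof. by rewrite mulrDl [z^* * z]mulrC (conj_mul_prim p_pr z_prim) addrK. Qed.

Lemma zsquare_neq1 : z ^+ 2 != 1.
Proof.
rewrite -(prim_order_dvd z_prim) dvdn_prime2 //.
by apply: contraTneq p_odd => ->.
Qed.

Lemma zconj_neq : z^* - z != 0.
Proof.
rewrite subr_eq0; apply: contraNneq zsquare_neq1 => zz.
by rewrite expr2 -{2}zz (conj_mul_prim p_pr z_prim).
Qed.

Lemma real_cyclo_int_tau : real_cyclo_int z tau.
Proof.
split; first 1 last.
- by apply/CrealP; rewrite rmorphD /= conjCK addrC.
- by rewrite rpredD ?Aint_aut // ?(Aint_prim_root z_prim).
rewrite /real_trace (conj_prim p_pr z_prim).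
by apply: cyclo_fieldD (cyclo_fieldX _ _); rewrite -[z]expr1; apply: cyclo_fieldX.
Qed.

(** [z^2] is again a primitive root, so [z tau = 1 + z^2] is a cyclotomic unit. *)
Lemma real_trace_unit : exists2 t, real_cyclo_int z t & tau * t = 1.
Proof.
pose m := p./2.+1; pose g := \sum_(k < m) (z ^+ 4) ^+ k.
have gE : tau * (z * g) = 1.
  have z2 : z ^+ 2 - 1 != 0 by rewrite subr_eq0 zsquare_neq1.
  apply: (mulfI z2).
  have tz : tau * z = z ^+ 2 + 1 by rewrite expr2 zsquare subrK.
  rewrite mulrA tz mulrA mulr1.
  have -> : (z ^+ 2 - 1) * (z ^+ 2 + 1) = z ^+ 4 - 1.
    by rewrite -subr_sqr expr1n -exprM.
  rewrite -subrX1 -exprM; congr (_ - 1).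
  have -> : (4 * m = p * 2 + 2)%N.
    by have := odd_double_half p; rewrite p_odd /m; lia.
  by rewrite exprD exprM (prim_expr_order z_prim) expr1n mul1r.
exists (z * g) => //.
have gF k : \sum_(i < k) (z ^+ 4) ^+ i \in Aint /\
    cyclo_field z (\sum_(i < k) (z ^+ 4) ^+ i).
  elim: k => [|k [IHa IHf]].
    by rewrite big_ord0; split; [exact: rpred0 | exists 0; rewrite rmorph0 horner0].
  rewrite big_ord_recr /= -exprM; split.
    by rewrite rpredD // rpredX // (Aint_prim_root z_prim).
  exact: cyclo_fieldD (cyclo_fieldX _ _).
have [ga gf] := gF m; split.
- by apply: cyclo_fieldM gf; rewrite -[z]expr1; apply: cyclo_fieldX.
- have t0 : tau != 0 by apply: contra_eq_neq gE => ->; rewrite mul0r eq_sym oner_neq0.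
  have -> : z * g = tau^-1 by apply: (mulfI t0); rewrite gE mulfV.
  by rewrite realV; case: real_cyclo_int_tau.
- by rewrite rpredM // (Aint_prim_root z_prim).
Qed.

Variable U : real_ideal z.
Local Notation inU := (ideal_set U).

Lemma ideal_zsubgroup : zsubgroup inU.
Proof. by split; [exact: ideal0 | exact: idealB]. Qed.

(** [U Z[z] = U z + U], since the right-hand side is closed under
    multiplication by [z]. *)
Lemma extended_idealP x :
  extended_ideal inU x <-> exists a b, [/\ inU a, inU b & x = z * a + b].
Proof.
have [U0 UB] := ideal_zsubgroup.
have UN a : inU a -> inU (- a) by rewrite -sub0r; apply: UB.
have UD a b : inU a -> inU b -> inU (a + b).
  by move=> Ua Ub; rewrite -[b]opprK; apply: UB => //; apply: UN.
have UT a : inU a -> inU (tau * a).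
  exact: idealM real_cyclo_int_tau.
pose P x := exists a b, [/\ inU a, inU b & x = z * a + b].
have PD u v : P u -> P v -> P (u + v).
  move=> [a [b [Ua Ub ->]]] [a' [b' [Ua' Ub' ->]]].
  by exists (a + a'), (b + b'); rewrite mulrDr addrACA; split=> //; apply: UD.
have PN u : P u -> P (- u).
  move=> [a [b [Ua Ub ->]]]; exists (- a), (- b).
  by rewrite opprD mulrN; split=> //; apply: UN.
have P0 : P 0 by exists 0, 0; rewrite mulr0 addr0; split.
have Pz u : P u -> P (z * u).
  move=> [a [b [Ua Ub ->]]]; exists (tau * a + b), (- a).
  split; [exact: UD (UT _ Ua) Ub | exact: UN |].
  by rewrite mulrDr mulrA zsquare; ring.
have PM u (k : int) : P u -> P (k%:~R * u).
  move=> Pu; have Pn (n : nat) : P (n%:R * u).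
    by elim: n => [|n IH]; rewrite ?mul0r // -natr1 mulrDl mul1r; apply: PD.
  by case: k => n; [exact: Pn | rewrite NegzE mulrNz mulNr; apply/PN/Pn].
split=> [[r [rU ->]]|[a [b [Ua Ub ->]]]]; last first.
  exists [:: (a, z); (b, 1)]; split; last first.
    by rewrite !big_cons big_nil addr0 mulr1 [a * z]mulrC.
  move=> t; rewrite !inE => /orP[] /eqP->; split=> //=.
    by exists 'X; rewrite map_polyX hornerX.
  by exists 1; rewrite rmorph1 hornerC.
rewrite big_seq; elim/big_ind: _ => // t /rU[Ut [q ->]].
elim/poly_ind: q => [|q c IH]; first by rewrite rmorph0 horner0 mulr0.
rewrite rmorphD rmorphM /= map_polyX map_polyC hornerMXaddC mulrDr.
apply: PD; first by rewrite mulrA [_ * z]mulrC; apply: Pz.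
rewrite mulrC; apply: PM; exists 0, t.1.
by rewrite mulr0 add0r; split.
Qed.

Lemma ideal_real x : inU x -> x^* = x.
Proof. by move=> /ideal_sub[_ /CrealP]. Qed.

Lemma ideal_basis_exists : exists r (u : 'I_r -> algC), zfree_basis inU u.
Proof.
apply: (@zfree_basis_exists _ p (fun k x => cyclo_trace p_pr (x * z ^+ k))).
- exact: ideal_zsubgroup.
- by move=> k x y; rewrite mulrBl cyclo_traceB.
- move=> k x /ideal_sub[fx _ ax]; apply: (cyclo_trace_int p_pr z_prim).
    exact: cyclo_fieldM fx (cyclo_fieldX _ _).
  by rewrite rpredM // rpredX // (Aint_prim_root z_prim).
- by move=> x _; apply: (cyclo_trace_inj (p_pr := p_pr) z_prim).
Qed.

Lemma extended_basis r (u : 'I_r -> algC) : zfree_basis inU u ->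
  zfree_basis (extended_ideal U) (famcat ( *%R z \o u) u).
Proof.
move=> bu; have [Uu sp fr] := bu; have [U0 _] := ideal_zsubgroup.
have lz a : lincomb ( *%R z \o u) a = z * lincomb u a.
  by rewrite (zmap_lincomb (mulrBr z)).
have Ul a : inU (lincomb u a) by apply: zsubgroup_lincomb => //; apply: ideal_zsubgroup.
split.
- apply: famcatP => i; apply/extended_idealP.
    by exists (u i), 0; rewrite addr0.
  by exists 0, (u i); rewrite mulr0 add0r.
- move=> x /extended_idealP[_ [_ [/sp[a ->] /sp[b ->] ->]]].
  by exists (row_mx a b); rewrite lincomb_cat lz.
move=> c; rewrite -[c]hsubmxK lincomb_cat lz; move: (lsubmx c) (rsubmx c) => a b ab0.
(* subtracting the complex conjugate isolates the coefficient of [z] *)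
have : (z^* - z) * lincomb u a = 0.
  have := congr1 (fun x : algC => x^*) ab0; rewrite rmorphD rmorphM rmorph0 /=.
  rewrite !(ideal_real (Ul _)) => ab0'.
  transitivity ((z^* * lincomb u a + lincomb u b) - (z * lincomb u a + lincomb u b)).
    by rewrite mulrBl opprD addrACA subrr addr0.
  by rewrite ab0 ab0' subrr.
move/eqP; rewrite mulf_eq0 (negPf zconj_neq) /= => /eqP/[dup] a0 /fr ->.
by move: ab0; rewrite a0 mulr0 add0r => /fr ->; exact: row_mx0.
Qed.

(** [4 - T^2] is the matrix of multiplication by minus the square of [z^* - z],
    an element of norm [p]. *)
Record ideal_matrix r (u : 'I_r -> algC) (T T' : 'M[int]_r) : Prop := IdealMatrix {
  im_basis : zfree_basis inU u;
  im_tau : forall i, tau * u i = fammul T u i;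
  im_unit : T *m T' = 1%:M;
  im_det : \det (4%:R%:M - T *m T) = p%:Z }.

Lemma ideal_matrix_exists :
  exists r (u : 'I_r -> algC) T T', ideal_matrix u T T'.
Proof.
have [r [u bu]] := ideal_basis_exists; exists r, u; have [Uu sp fr] := bu.
have mulU t : real_cyclo_int z t -> exists T : 'M_r, forall i, t * u i = fammul T u i.
  by move=> Rt; apply: (zfree_coord bu) => i; apply: idealM.
have [t Rt tt] := real_trace_unit.
have [T uT] := mulU _ real_cyclo_int_tau; have [T' uT'] := mulU _ Rt.
exists T, T'; split=> //.
- apply: mulmx1C; apply/row_matrixP => i; apply: (zfree_inj bu).
  rewrite -/(fammul _ u i) -fammulA row1 lincomb_delta /fammul.
  rewrite -(eq_lincomb _ uT) -(zmap_lincomb (mulrBr tau)) -/(fammul T' u i) -uT'.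
  by rewrite mulrA tt mul1r.
- have bv := extended_basis bu; have [_ _ frv] := bv.
  apply: (@det_cyclo_companion p z p_pr p_odd z_prim _ _ (famcat ( *%R z \o u) u)).
  + apply: contrapT => v0.
    have [x Ux] := ideal_neq0 U; have [c ->] := sp x Ux; case/eqP.
    rewrite /lincomb big1 // => i _; have [->|ui] := eqVneq (u i) 0.
      by rewrite mul0rz.
    by case: v0; exists (rshift r i); rewrite famcat_r.
  + apply: (cyclo_independent_size p_pr z_prim _ frv).
    apply: (famcatP (P := cyclo_field z)) => i.
      rewrite /= -[z in X in _ X]expr1; apply: cyclo_fieldM (cyclo_fieldX _ _) _.
      by have /ideal_sub[] := Uu i.
    by have /ideal_sub[] := Uu i.
  + move=> i; rewrite -(splitK i) /fammul; case: (split i) => j /=.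
      rewrite famcat_l /block_mx rowKu row_row_mx lincomb_cat /=.
      rewrite linearN /= lincombN row1 lincomb_delta.
      rewrite -(zmap_lincomb (mulrBr z)) -/(fammul T u j) -uT mulrA zsquare.
      by rewrite mulrBl mul1r mulrAC [_ * z]mulrC mulrA.
    rewrite famcat_r /block_mx rowKd row_row_mx lincomb_cat row1 lincomb_delta.
    by rewrite row0 lincomb0 addr0.
Qed.
End RealIdeal.

(** * Extensions by cyclotomic lattices *)

Section Lattices.
Variables (p : nat) (gT : finGroupType) (s w : gT).
Hypotheses (p_pr : prime p) (p_odd : odd p) (dih : dihedral_gens p s w).

Lemma zfree_image (V W : zmodType) (f : V -> W) (L : set V) n (e : 'I_n -> V) :
  (forall x y, f (x - y) = f x - f y) -> injective f -> zfree_basis L e ->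
  zfree_basis (f @` L)%classic (f \o e).
Proof.
move=> fB finj [Le sp fr]; split=> [i|_ [x /sp[c ->] <-]|c].
- by exists (e i).
- by exists c; rewrite zmap_lincomb.
- by rewrite -zmap_lincomb // -[RHS](zmap0 fB) => /finj/fr.
Qed.

(** As [p] is prime to [n], the vector [e] is a combination of [p e] and [n e]. *)
Lemma zsubgroup_bezout (V : zmodType) (P : set V) (e : V) (n : int) :
  zsubgroup P -> P (e *+ p) -> P (e *~ n) -> ~~ (p %| n)%Z -> P e.
Proof.
move=> Pg Pp Pn pn.
have : coprimez p n by rewrite coprimezE prime_coprime.
case/coprimezP => -[u v] /= uv.
rewrite -[e]mulr1z -uv [u * _]mulrC [v * _]mulrC mulrzDr !mulrzA.
by apply: zsubgroupD => //; apply: zsubgroupMz.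
Qed.

Section Transport.
Variables (X M : zgmodule gT) (i : X -> M).
Hypotheses (ih : zg_hom i) (ii : injective i).

Lemma cyclotomic_transport r1 r2 (x1 : 'I_r1 -> X) (x2 : 'I_r2 -> X) T1 T2 T2' :
  cyclotomic_lattice s w setT x1 x2 T1 T2 T2' ->
  cyclotomic_lattice s w (range i) (i \o x1) (i \o x2) T1 T2 T2'.
Proof.
move=> [_ bas s1 s2 t1 t2 u]; have [iB ia] := ih; split=> //.
- split; first by exists 0 => //; rewrite (zmap0 iB).
  by move=> _ _ [a _ <-] [b _ <-]; exists (a - b).
- apply: eq_zfree (zfree_image iB ii bas) => // k.
  rewrite /famcat /=; case: (split k) => j /=; last by case: (split j).
  by rewrite ia; case: (split j).
- by move=> j; rewrite /= -ia s1.
- by move=> j; rewrite /= -ia s2 (zmapN iB).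
- by move=> j; rewrite /= -!ia -(zmapD iB) t1 /fammul (zmap_lincomb iB).
- by move=> j; rewrite /= -!ia -(zmapD iB) t2 /fammul (zmap_lincomb iB).
Qed.
End Transport.

(** By [gram_cyclotomic], [k] is the quotient of the Gram determinant of [X] by
    the square of the one of [X^s] for half the pairing, for every invariant
    pairing. *)
Definition cyclotomic_module (X : zgmodule gT) (k : rat) : Prop :=
  (forall x : X, zg_act w x = x -> x = 0) /\
  exists r1 r2 (x1 : 'I_r1 -> X) (x2 : 'I_r2 -> X) T1 T2 T2',
    [/\ cyclotomic_lattice s w setT x1 x2 T1 T2 T2',
        \det (4%:R%:M - T2 *m T2) != 0 &
        k = (\det (4%:R%:M - T1 *m T1))%:~R / (\det (4%:R%:M - T2 *m T2))%:~R].

Section Extension.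
Variables (X Y M : zgmodule gT) (k : rat).
Hypothesis Xk : cyclotomic_module X k.
Hypothesis Yw : forall y : Y, zg_act w y = y.
Variables (i : X -> M) (q : M -> Y).
Hypothesis iq : short_exact i q.

Lemma exact_ker_fixed m : q m = 0 -> zg_act w m = m -> m = 0.
Proof.
have [[iB ia] qh ii _ ex] := iq => /ex[x <-]; rewrite -ia => /ii xw.
by rewrite (Xk.1 _ xw) (zmap0 iB).
Qed.

Lemma dokchitser_exact r (eY : 'I_r -> Y) a (eS : 'I_a -> Y)
    (D : 'M_r) (D' : 'M_a) :
  zfree_basis setT eY -> zfree_basis [set y | zg_act s y = y]%classic eS ->
  zfree_basis (lift_image w q) (fammul D eY) ->
  zfree_basis [set y | lift_image w q y /\ zg_act s y = y]%classic
    (fammul D' eS) ->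
  dokchitser M (Theta_dihedral s w) =
    k * (\det D')%:~R ^+ 4 / (\det D)%:~R ^+ 2 * p%:R ^+ r / p%:R ^+ (2 * a).
Proof.
move=> beY beS bD bD'; have [ih qh ii qs ex] := iq.
have [_ [r1 [r2 [x1 [x2 [T1 [T2 [T2' [cyc d2 ->]]]]]]]]] := Xk.
have cycM := cyclotomic_transport ih ii cyc.
have kerE m : range i m <-> q m = 0.
  by rewrite ex; split=> [[x _ <-]|[x <-]]; exists x.
apply: (dokchitser_extension p_pr p_odd dih qh qs Yw exact_ker_fixed
  (x := famcat (zg_act w \o famcat (i \o x1) (i \o x2)) (famcat (i \o x1) (i \o x2)))
  (xs := fixed_family w (i \o x1) (i \o x2)) _ _ _ beY beS bD bD').
- exact: (eq_zfree kerE _ (cyc_basis cycM)).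
- apply: (eq_zfree _ _ (fixed_family_basis dih cycM)) => // m.
  by split=> -[/kerE qm sm]; split=> //; apply/kerE.
- by move=> B bB Binv; exact: (gram_cyclotomic dih cycM bB Binv d2).
Qed.

(** The obstruction to lifting [q m] to an invariant of [w] is the class of
    [w m - m] in [X / (w - 1) X], where [w] acts trivially. As [s w = w^-1 s], the
    reflection multiplies this class by [- sg] when [s m = sg m]. If [s] acts on
    [X / (w - 1) X] by [sg], then twice the class is zero; so is [p] times the
    class, because the norm of [w m - m] is zero. *)
Lemma lift_sign (sg : int) m :
  sg = 1 \/ sg = -1 ->
  (forall x : X, exists x', zg_act s x - x *~ sg = zg_act w x' - x') ->
  zg_act s m = m *~ sg -> lift_image w q (q m).
Proof.
move=> sg1 Xsg sm; have [[iB ia] [qB qa] ii qs ex] := iq.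
pose J : set M := [set t | exists x, t = zg_act w (i x) - i x]%classic.
have Jg : zsubgroup J.
  split; first by exists 0; rewrite (zmap0 iB) act0 subrr.
  move=> _ _ [x ->] [y ->]; exists (x - y).
  by rewrite iB zg_actB !opprB addrACA [RHS]addrACA [- i x + _]addrC.
pose t := zg_act w m - m.
have qt : q t = 0 by rewrite qB qa Yw subrr.
have [y yt] : exists y, i y = t by apply/ex.
have Jw x : J (i x - zg_act w^-1%g (i x)).
  by exists (zg_act w^-1%g x); rewrite -!ia actKV.
suff [x tx] : J t.
  exists (m - i x); last by rewrite qB (_ : q (i x) = 0) ?subr0 //; apply/ex; exists x.
  have -> : zg_act w (m - i x) = t - (zg_act w (i x) - i x) + (m - i x).
    rewrite zg_actB /t opprB [X in _ = X + _]addrC -[RHS]addrA [X in _ = _ + X]addrA subrK.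
    by rewrite [RHS]addrC addrA subrK.
  by rewrite -tx subrr add0r.
(* applying the hypothesis on [X] to [t] gives [2 t], and the norm of [t], which
   is zero, gives [p t] *)
have J2 : J (t *~ 2).
  have -> : t *~ 2 = (t + zg_act w^-1%g t) + (t - zg_act w^-1%g t).
    by rewrite addrACA subrr addr0 -[2]/(1 + 1) mulrzDr mulr1z.
  apply: zsubgroupD => //; last by rewrite -yt; apply: Jw.
  have [x' yx'] := Xsg y.
  have sgK (v : M) : v *~ sg *~ sg = v by case: sg1 => ->; rewrite -mulrzA mulr1z.
  have st : zg_act s t = - zg_act w^-1%g t *~ sg.
    by rewrite /t !zg_actB (act_sw dih) sm (zmapMz (zg_actB _)) actVK opprB mulrzBl.
  have -> : t + zg_act w^-1%g t = - ((zg_act s t - t *~ sg) *~ sg).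
    by rewrite st -mulrzBl sgK opprB opprK addrC.
  apply/(zsubgroupN Jg)/(zsubgroupMz _ Jg); exists x'.
  by rewrite -yt -!ia -(zmapMz iB) -!iB yx'.
have Jp : J (t *+ p).
  have -> : t *+ p = \sum_(h in <[w]>%g) (t - zg_act h t).
    rewrite sumrB sumr_const -orderE (dih_order p_pr dih) -/(wnorm w t).
    by rewrite (ker_wnorm (conj qB qa) exact_ker_fixed qt) subr0.
  elim/big_ind: _ => [|u v|_ /cycleP[j ->]]; [by case: Jg | exact: zsubgroupD |].
  elim: j => [|j IH]; first by rewrite expg0 zg_act1 subrr; case: Jg.
  rewrite -[t in t - _](subrK (zg_act (w ^+ j)%g t)) -addrA.
  apply: zsubgroupD => //; rewrite -opprB; apply: zsubgroupN => //.
  exists (zg_act (w ^+ j)%g y); by rewrite ia yt expgS zg_actM.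
have -> : t = t *+ p - t *~ 2 *~ p./2%:Z.
  rewrite -mulrzA -[t *+ p]/(t *~ p%:Z) -mulrzBr -[LHS]mulr1z; congr (_ *~ _).
  by have := odd_double_half p; rewrite p_odd; lia.
apply: Jg.2 => //; exact: zsubgroupMz.
Qed.

End Extension.
End Lattices.

Section SignedLattices.
Variables (p : nat) (gT : finGroupType) (s w : gT).

(** The building blocks of [cyclotomic_lattice]: the sign is 1 for [x1] and -1 for
    [x2]. *)
Definition signed_lattice (M : zgmodule gT) (X : set M) (sg d : int) : Prop :=
  exists r (x : 'I_r -> M) T T',
    [/\ zfree_basis X (famcat (zg_act w \o x) x),
        forall i, zg_act s (x i) = x i *~ sg,
        rotation_trace w x T, T *m T' = 1%:M & \det (4%:R%:M - T *m T) = d].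

Lemma signed_lattice0 (M : zgmodule gT) sg : signed_lattice [set (0 : M)]%classic sg 1.
Proof.
exists 0, (fun=> 0), 0, 0; split=> [|[]//|[]//||]; last exact: det_mx00.
  split=> [i|x ->|c _]; first by case: i.
    by exists 0; rewrite lincomb0.
  by apply/rowP => -[].
by apply/matrixP => -[].
Qed.

Lemma signed_lattice_image (X M : zgmodule gT) (i : X -> M) sg d :
  zg_hom i -> injective i -> signed_lattice (setT : set X) sg d ->
  signed_lattice (range i) sg d.
Proof.
move=> [iB ia] ii [r [x [T [T' [bx sx tx u dT]]]]].
exists r, (i \o x), T, T'; split=> // [|j|j].
- apply: eq_zfree (zfree_image iB ii bx) => // k.
  by rewrite /famcat /=; case: (split k) => j //=; rewrite ia.
- by rewrite /= -ia sx (zmapMz iB).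
- by rewrite /= -!ia -(zmapD iB) tx /fammul (zmap_lincomb iB).
Qed.

Lemma cyclotomic_module_sum (M : zgmodule gT) (X1 X2 : set M) d1 d2 :
  (forall m : M, zg_act w m = m -> m = 0) -> zsubgroup X1 -> zsubgroup X2 ->
  (forall m, exists a b, [/\ X1 a, X2 b & m = a + b]) ->
  (forall a b, X1 a -> X2 b -> a + b = 0 -> a = 0) -> d2 != 0 ->
  signed_lattice X1 1 d1 -> signed_lattice X2 (-1) d2 ->
  cyclotomic_module s w M (d1%:~R / d2%:~R).
Proof.
move=> Mw X1g X2g sp inj d20 [r1 [x1 [T1 [T1' [b1 s1 t1 u1 e1]]]]].
move=> [r2 [x2 [T2 [T2' [b2 s2 t2 u2 e2]]]]]; split=> //.
exists r1, r2, x1, x2, T1, T2, T2'; rewrite e1 e2; split=> //; split=> //.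
have [X1b sp1 fr1] := b1; have [X2b sp2 fr2] := b2.
split=> // [m _|c].
  have [_ [_ [/sp1[c1 ->] /sp2[c2 ->] ->]]] := sp m.
  exists (row_mx (row_mx (lsubmx c1) (lsubmx c2)) (row_mx (rsubmx c1) (rsubmx c2))).
  rewrite lincomb4 -[in LHS](hsubmxK c1) -[in LHS](hsubmxK c2) !lincomb_cat.
  by rewrite -!(zmap_lincomb (zg_actB w)) addrACA.
rewrite -[c]hsubmxK -[lsubmx c]hsubmxK -[rsubmx c]hsubmxK lincomb4.
move: (lsubmx (lsubmx c)) (rsubmx (lsubmx c)) => a1 a2.
move: (lsubmx (rsubmx c)) (rsubmx (rsubmx c)) => c1 c2.
rewrite addrACA !(zmap_lincomb (zg_actB w)) -!lincomb_cat lincomb_cat => e0.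
have l1 := inj _ _ (zsubgroup_lincomb _ X1g X1b) (zsubgroup_lincomb _ X2g X2b) e0.
move: e0; rewrite l1 add0r => /fr2; move/fr1: l1.
rewrite -[X in _ = X]row_mx0 => /eq_row_mx[-> ->].
by rewrite -[X in _ = X]row_mx0 => /eq_row_mx[-> ->]; rewrite !row_mx0.
Qed.

Hypotheses (p_pr : prime p) (p_odd : odd p) (dih : dihedral_gens p s w).

Section Embedded.
Variables (z : algC) (z_prim : p.-primitive_root z) (U : real_ideal z).
Variables (X : zgmodule gT) (sg : int).

(** Up to the sign [sg], the action of [s] on an extended ideal is complex
    conjugation; dividing by [z^* - z] puts the twisted ideal in this form. *)
Definition ideal_embedding (v : X -> algC) : Prop :=
  [/\ forall x y, v (x - y) = v x - v y, injective v,
      forall a, extended_ideal U a <-> exists x, v x = a,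
      forall x, v (zg_act s x) = (v x)^* *~ sg &
      forall x, v (zg_act w x) = z * v x].

Variable v : X -> algC.
Hypothesis vE : ideal_embedding v.

Lemma embedding_fixed (x : X) : zg_act w x = x -> x = 0.
Proof.
have [vB vi _ _ vw] := vE; move=> wx; apply: vi; rewrite (zmap0 vB).
have := vw x; rewrite wx => /eqP; rewrite -[X in X == _]mul1r -subr_eq0 -mulrBl.
rewrite mulf_eq0 subr_eq0 => /orP[/eqP z1|/eqP //].
by have := zsquare_neq1 p_pr p_odd z_prim; rewrite -z1 expr1n eqxx.
Qed.

Lemma embedding_signed : signed_lattice (setT : set X) sg p%:Z.
Proof.
have [vB vi vr vs vw] := vE.
have [r [u [T [T' [bu uT TT dT]]]]] := ideal_matrix_exists p_pr p_odd z_prim U.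
have [Uu _ _] := bu; have [U0 _] := ideal_zsubgroup U.
have /choice[x xu] i : exists x, v x = u i.
  apply/vr/(extended_idealP p_pr z_prim); exists 0, (u i).
  by rewrite mulr0 add0r.
have vw' (y : X) : v (zg_act w^-1%g y) = z^* * v y.
  rewrite -[y in RHS](actKV w) vw mulrA [z^* * z]mulrC.
  by rewrite (conj_mul_prim p_pr z_prim) mul1r.
exists r, x, T, T'; split=> // [|i|i].
- apply: (zfree_iso vB (LW := extended_ideal U)) => // [y _ vy|y _|].
  + by apply: vi; rewrite vy (zmap0 vB).
  + by apply/vr; exists y.
  + apply: eq_zfree (extended_basis p_pr p_odd z_prim bu) => // k.
    by rewrite /famcat /=; case: (split k) => j /=; rewrite ?vw xu.
- by apply: vi; rewrite vs xu (zmapMz vB) xu (ideal_real (Uu i)).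
- apply: vi; rewrite (zmapD vB) vw vw' -mulrDl xu -/(real_trace z) uT.
  by rewrite /fammul (zmap_lincomb vB); apply: eq_lincomb => j; rewrite /= xu.
Qed.

(** [(z a + b)^* - (z a + b) = (z^* - z) a], a multiple of [z - 1]. *)
Lemma embedding_sign (x : X) :
  exists x', zg_act s x - x *~ sg = zg_act w x' - x'.
Proof.
have [vB vi vr vs vw] := vE.
have /(extended_idealP p_pr z_prim)[a [b [Ua Ub vx]]] : extended_ideal U (v x).
  by apply/vr; exists x.
have [x' vx'] : exists x', v x' = z * a - (a + real_trace z * a).
  apply/vr/(extended_idealP p_pr z_prim); exists a, (- (a + real_trace z * a)).
  split=> //; have Ug := ideal_zsubgroup U.
  apply: zsubgroupN => //; apply: zsubgroupD => //.
  exact: idealM (real_cyclo_int_tau p_pr z_prim) Ua.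
exists (x' *~ sg); apply: vi.
rewrite !vB vs vw !(zmapMz vB) mulrzAr -!mulrzBl; congr (_ *~ _).
rewrite vx' vx rmorphD rmorphM /= (ideal_real Ua) (ideal_real Ub) /real_trace.
transitivity (z^* * a + a - z * a - z * z^* * a).
  by rewrite (conj_mul_prim p_pr z_prim); ring.
by ring.
Qed.
End Embedded.
End SignedLattices.

Section CyclotomicModules.
Variables (p : nat) (gT : finGroupType) (s w : gT).
Hypotheses (p_pr : prime p) (p_odd : odd p) (dih : dihedral_gens p s w).
Variables (z : algC) (z_prim : p.-primitive_root z) (U : real_ideal z).
Local Notation A := (zg_A p_pr dih z_prim U).
Local Notation A' := (zg_A' p_pr dih z_prim U).

Lemma zg_sub_val (M : zgmodule gT) (P : set M) (Pst : zg_stable P) :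
  exists v : zg_sub Pst -> M,
    [/\ zg_hom v, injective v & forall a, P a <-> exists x, v x = a].
Proof.
exists (fun x : sub_sort Pst => \val x); split=> //.
- exact: val_inj.
- move=> a; split=> [Pa|[x <-]]; last by apply/asboolP; apply: (valP x).
  have aP : a \in sub_pred Pst by apply/asboolP.
  by exists (Sub a aP : sub_sort Pst); rewrite SubK.
Qed.

Lemma zg_A_embedding : exists v : A -> algC, ideal_embedding s w U 1 v.
Proof.
have [v [[vB va] vi vr]] := zg_sub_val (zg_A_subproof p_pr dih z_prim U).
exists v; split=> // [x|x]; rewrite va.
  by rewrite mulr1z dih_module_s.
by rewrite dih_module_w.
Qed.

Lemma zg_A'_embedding : exists v : A' -> algC, ideal_embedding s w U (-1) v.
Proof.
have [v [[vB va] vi vr]] := zg_sub_val (zg_A'_subproof p_pr dih z_prim U).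
have d0 := zconj_neq p_pr p_odd z_prim.
exists (fun x => (z^* - z)^-1 * v x); split.
- by move=> x y; rewrite vB mulrBr.
- by move=> x y /(mulfI (invr_neq0 d0))/vi.
- move=> a; split=> [Ua|[x <-]].
    have /vr[x vx] : twisted_ideal U ((z^* - z) * a) by exists a.
    by exists x; rewrite vx mulKf.
  have /vr : exists y, v y = v x by exists x.
  by case=> b Ub <-; rewrite mulKf.
- move=> x; rewrite va dih_module_s rmorphM fmorphV rmorphB /= conjCK -opprB.
  by rewrite invrN mulNr.
- by move=> x; rewrite va dih_module_w mulrCA.
Qed.

Lemma zsubgroup0 (V : zmodType) : zsubgroup [set (0 : V)]%classic.
Proof. by split=> // _ _ -> ->; rewrite subrr. Qed.

Lemma p_neq0 : p%:Z != 0.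
Proof. by rewrite -lt0n prime_gt0. Qed.

Lemma cyclotomic_zg_A : cyclotomic_module s w A p%:R.
Proof.
have [v vE] := zg_A_embedding.
rewrite -[p%:R]divr1.
apply: (@cyclotomic_module_sum _ s w A setT [set (0 : A)]%classic p 1) => //.
- exact: (embedding_fixed p_pr p_odd z_prim vE).
- exact: zsubgroup0.
- by move=> m; exists m, 0; rewrite addr0.
- by move=> a b _ ->; rewrite addr0.
- exact: (embedding_signed p_pr p_odd z_prim vE).
- exact: signed_lattice0.
Qed.

Lemma cyclotomic_zg_A' : cyclotomic_module s w A' p%:R^-1.
Proof.
have [v vE] := zg_A'_embedding.
rewrite -[p%:R^-1]mul1r.
apply: (@cyclotomic_module_sum _ s w A' [set (0 : A')]%classic setT 1 p) => //.
- exact: (embedding_fixed p_pr p_odd z_prim vE).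
- exact: zsubgroup0.
- by move=> m; exists 0, m; rewrite add0r.
- exact: p_neq0.
- exact: signed_lattice0.
- exact: (embedding_signed p_pr p_odd z_prim vE).
Qed.

Lemma cyclotomic_zg_sum : cyclotomic_module s w (zg_sum A A') 1.
Proof.
have [v vE] := zg_A_embedding; have [v' vE'] := zg_A'_embedding.
pose i1 (x : A) : zg_sum A A' := (x, 0).
pose i2 (x : A') : zg_sum A A' := (0, x).
have h1 : zg_hom i1.
  split=> [x y|g x]; first by congr pair; rewrite subrr.
  by congr pair; rewrite act0.
have h2 : zg_hom i2.
  split=> [x y|g x]; first by congr pair; rewrite subrr.
  by congr pair; rewrite act0.
have rangeg (X M : zgmodule gT) (i : X -> M) : zg_hom i -> zsubgroup (range i).
  move=> [iB _]; split; first by exists 0 => //; apply: zmap0.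
  by move=> _ _ [x _ <-] [y _ <-]; exists (x - y).
have p0 : p%:R != 0 :> rat by have := p_neq0; rewrite -(intr_eq0 rat).
rewrite -(divff p0).
apply: (@cyclotomic_module_sum _ s w _ (range i1) (range i2) p p).
- case=> x y xy.
  have /= /(embedding_fixed p_pr p_odd z_prim vE) -> := congr1 (fun t => t.1) xy.
  by have /= /(embedding_fixed p_pr p_odd z_prim vE') -> := congr1 (fun t => t.2) xy.
- exact: rangeg.
- exact: rangeg.
- case=> x y; exists (i1 x), (i2 y); split; [by exists x | by exists y |].
  by congr pair; rewrite /= ?addr0 ?add0r.
- move=> _ _ [x _ <-] [y _ <-] xy.
  by have /= := congr1 (fun t => t.1) xy; rewrite addr0 => ->.
- exact: p_neq0.
- apply: signed_lattice_image => //; first by move=> x y /(congr1 (fun t => t.1)).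
  exact: (embedding_signed p_pr p_odd z_prim vE).
- apply: signed_lattice_image => //; first by move=> x y /(congr1 (fun t => t.2)).
  exact: (embedding_signed p_pr p_odd z_prim vE').
Qed.
End CyclotomicModules.

(** * The quotient modules *)

Section Quotients.
Variables (p : nat) (gT : finGroupType) (s w : gT).
Hypotheses (p_pr : prime p) (p_odd : odd p) (dih : dihedral_gens p s w).
Local Notation C M := (dokchitser M (Theta_dihedral s w)).

Lemma p_rat_neq0 : p%:R != 0 :> rat.
Proof. by rewrite pnatr_eq0 -lt0n prime_gt0. Qed.

Lemma zfree_single (V : zmodType) (L : set V) (x : V) :
  L x -> (forall v, L v -> exists k, v = x *~ k) ->
  (forall k, x *~ k = 0 -> k = 0) -> zfree_basis L (fun _ : 'I_1 => x).
Proof.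
move=> Lx sp fr; split=> // [v /sp[k ->]|c].
  by exists (\row_i k); rewrite /lincomb big_ord1 mxE.
rewrite /lincomb big_ord1 => /fr c0.
by apply/rowP => i; rewrite ord1 c0 mxE.
Qed.

Lemma zfree_pair (V : zmodType) (L : set V) (x y : V) :
  L x -> L y -> (forall v, L v -> exists a b, v = x *~ a + y *~ b) ->
  (forall a b, x *~ a + y *~ b = 0 -> a = 0 /\ b = 0) ->
  zfree_basis L (famcat (fun _ : 'I_1 => x) (fun _ : 'I_1 => y)).
Proof.
have single (v : V) (c : 'rV_1) : lincomb (fun _ : 'I_1 => v) c = v *~ c 0 0.
  by rewrite /lincomb big_ord1.
move=> Lx Ly sp fr; split=> [|v /sp[a [b ->]]|c].
- exact: famcatP.
- by exists (row_mx (\row_i a) (\row_i b)); rewrite lincomb_cat !single !mxE.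
- rewrite -[c]hsubmxK lincomb_cat !single => /fr[a0 b0]; rewrite -[RHS]row_mx0.
  by congr row_mx; apply/rowP => i; rewrite ord1 [RHS]mxE.
Qed.

Lemma zero_module : exists Z : zgmodule gT, forall x : Z, x = 0.
Proof.
have st : zg_stable [set (0 : zg_trivial gT)]%classic.
  by split=> // x y -> ->; rewrite subrr.
have [v [[vB _] vi vr]] := zg_sub_val st; exists (zg_sub st) => x.
apply: vi; rewrite (zmap0 vB).
by have /vr // : exists y, v y = v x by exists x.
Qed.

Lemma zfree_zero (V : zmodType) (L : set V) (f : 'I_0 -> V) :
  L 0 -> (forall v, L v -> v = 0) -> zfree_basis L f.
Proof.
move=> L0 LL; split=> [[]//|v /LL ->|c _]; first by exists 0; rewrite lincomb0.
by apply/rowP => -[].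
Qed.

(** A module fixed by the rotations is an extension of itself by zero. *)
Lemma zero_exact (Y : zgmodule gT) :
  exists (X : zgmodule gT) (i : X -> Y), cyclotomic_module s w X 1 /\
    short_exact i (fun y : Y => y).
Proof.
have [Z Z0] := zero_module; exists Z, (fun _ => 0); split; last first.
  split=> //; first by split=> [x y|g x]; rewrite ?subrr ?act0.
  - by move=> x y _; rewrite (Z0 x) (Z0 y).
  - by move=> y; exists y.
  - by move=> m; split=> [->|[_ <-] //]; exists 0.
rewrite -[1]divr1; apply: (@cyclotomic_module_sum _ s w _
  [set 0]%classic [set 0]%classic 1 1) => //.
- exact: zsubgroup0.
- exact: zsubgroup0.
- by move=> m; exists 0, 0; split=> //; rewrite addr0.
- exact: signed_lattice0.
- exact: signed_lattice0.
Qed.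

(** A cyclotomic module is an extension of zero by itself. *)
Lemma dokchitser_cyclotomic (X : zgmodule gT) k : cyclotomic_module s w X k -> C X = k.
Proof.
move=> Xk; have [Z Z0] := zero_module.
have iq : short_exact (fun x : X => x) (fun _ : X => 0 : Z).
  split=> //; first by split=> [x y|g x]; rewrite ?subrr ?act0.
  - by move=> y; exists 0.
  - by move=> m; split=> // _; exists m.
have Zw (y : Z) : zg_act w y = y by rewrite (Z0 (zg_act w y)) (Z0 y).
have lift0 : lift_image w (fun _ : X => 0 : Z) 0 by exists 0; first exact: act0.
have zb (L : set Z) (f : 'I_0 -> Z) : L 0 -> zfree_basis L f.
  by move=> L0; apply: zfree_zero.
rewrite (dokchitser_exact p_pr p_odd dih Xk Zw iq (eY := fun _ : 'I_0 => 0)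
  (eS := fun _ : 'I_0 => 0) (D := 0) (D' := 0)); try apply: zb => //.
- by rewrite !det_mx00 muln0 !expr0 !expr1n !divr1 ?mulr1.
Qed.

Lemma nonsplit_lift (X Y M : zgmodule gT) (i : X -> M) (q : M -> Y) k :
  cyclotomic_module s w X k -> short_exact i q -> ~ splits q ->
  exists y, ~ lift_image w q y.
Proof.
move=> Xk iq ns; apply: contrapT => all; apply: ns.
have [_ qh _ _ _] := iq.
apply: (lift_image_splits p_pr dih qh (exact_ker_fixed Xk iq)) => y.
by apply: contrapT => ny; apply: all; exists y.
Qed.

Section RankOne.
Variables (Y : zgmodule gT) (e : Y).
Hypotheses (Yw : forall y : Y, zg_act w y = y).
Hypotheses (sp : forall y, exists k, y = e *~ k) (fr : forall k, e *~ k = 0 -> k = 0).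
Variables (X M : zgmodule gT) (i : X -> M) (q : M -> Y) (k : rat).
Hypotheses (Xk : cyclotomic_module s w X k) (iq : short_exact i q).

Lemma rank_one_basis : zfree_basis setT (fun _ : 'I_1 => e).
Proof. by apply: zfree_single. Qed.

(** The multiples of [p] always lift; if anything else did, [e] would, and the
    extension would split. *)
Lemma rank_one_lift : ~ splits q ->
  forall l, lift_image w q (e *~ l) <-> (p %| l)%Z.
Proof.
move=> ns l; have [_ qh _ qs _] := iq.
have Pg := lift_image_zsubgroup w qh.
have Pp y : lift_image w q (y *+ p) := lift_image_p p_pr dih qh qs Yw y.
split=> [el|/dvdzP[j ->]]; last by rewrite mulrzA; apply: Pp.
apply: contrapT => /negP pl; have [y] := nonsplit_lift Xk iq ns; case.
have [j ->] := sp y; apply: zsubgroupMz => //.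
exact: zsubgroup_bezout (Pp e) el pl.
Qed.

Lemma rank_one_lift_basis (n : int) : n != 0 ->
  (forall l, lift_image w q (e *~ l) <-> (n %| l)%Z) ->
  zfree_basis (lift_image w q) (fammul n%:M (fun _ : 'I_1 => e)).
Proof.
move=> n0 Pn; apply: eq_zfree (_ : zfree_basis (lift_image w q) (fun _ => e *~ n)) => //.
  by move=> j; rewrite /fammul /lincomb big_ord1 !mxE !ord1 eqxx.
apply: zfree_single => [|v|l]; first exact/Pn.
  have [l ->] := sp v; move=> /Pn/dvdzP[j ->].
  by exists j; rewrite mulrC mulrzA.
by rewrite -mulrzA => /fr/eqP; rewrite mulf_eq0 (negPf n0) => /eqP.
Qed.

Lemma dokchitser_trivial_quotient (n : int) : zg_act s e = e -> n != 0 ->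
  (forall l, lift_image w q (e *~ l) <-> (n %| l)%Z) ->
  C M = k * n%:~R ^+ 2 / p%:R.
Proof.
move=> se n0 Pn; have ss (y : Y) : zg_act s y = y.
  by have [l ->] := sp y; rewrite (zmapMz (zg_actB s)) se.
have bP := rank_one_lift_basis n0 Pn.
rewrite (dokchitser_exact p_pr p_odd dih Xk Yw iq rank_one_basis
  (eS := fun _ : 'I_1 => e) _ bP (D' := n%:M)).
- rewrite !det_scalar !expr1 muln1.
  have n0' : n%:~R != 0 :> rat by rewrite intr_eq0.
  by move: p_rat_neq0 => p0; field; rewrite n0' p0.
- by apply: eq_zfree rank_one_basis => // y; split=> // _; apply: ss.
- apply: eq_zfree bP => // y; split=> [Py|[] //]; split=> //; apply: ss.
Qed.

Lemma dokchitser_sign_quotient (n : int) : zg_act s e = - e -> n != 0 ->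
  (forall l, lift_image w q (e *~ l) <-> (n %| l)%Z) ->
  C M = k / n%:~R ^+ 2 * p%:R.
Proof.
move=> se n0 Pn; have s0 (y : Y) : zg_act s y = y -> y = 0.
  have [l ->] := sp y; rewrite (zmapMz (zg_actB s)) se => el.
  have /fr l0 : e *~ (l + l) = 0 by rewrite mulrzDr -{2}el mulNrz subrr.
  by have -> : l = 0 by lia.
have bP := rank_one_lift_basis n0 Pn.
rewrite (dokchitser_exact p_pr p_odd dih Xk Yw iq rank_one_basis
  (eS := fun _ : 'I_0 => e) _ bP (D' := 0)).
- by rewrite det_scalar expr1 det_mx00 muln0 expr0 expr1 expr1n divr1 mulr1.
- by apply: zfree_zero => //; exact: act0.
- apply: zfree_zero => [|y [_ /s0 //]]; split; last exact: act0.
  by rewrite -(mulr0z e); apply/Pn; rewrite dvdz0.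
Qed.
End RankOne.

Section Regular.
Variables (Y : zgmodule gT) (e f : Y).
Hypotheses (Yw : forall y : Y, zg_act w y = y) (se : zg_act s e = f).
Hypotheses (sp : forall y, exists a b, y = e *~ a + f *~ b).
Hypothesis fr : forall a b, e *~ a + f *~ b = 0 -> a = 0 /\ b = 0.
Variables (X M : zgmodule gT) (i : X -> M) (q : M -> Y) (k : rat).
Hypotheses (Xk : cyclotomic_module s w X k) (iq : short_exact i q).

Lemma regular_s a b : zg_act s (e *~ a + f *~ b) = e *~ b + f *~ a.
Proof.
by rewrite (zmapD (zg_actB s)) !(zmapMz (zg_actB s)) -se (act_ss dih) addrC.
Qed.

Lemma regular_inj a b a' b' :
  e *~ a + f *~ b = e *~ a' + f *~ b' -> a = a' /\ b = b'.
Proof.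
move=> E; have /fr[] : e *~ (a - a') + f *~ (b - b') = 0.
  by rewrite !mulrzBr addrACA -opprD E subrr.
by move=> /subr0_eq -> /subr0_eq ->.
Qed.

(** The conditions on [Q] say that the rows [(h, 0)] and [(c, d)] span the
    lattice of the coordinates of the elements that lift, and [(c', c')] its
    intersection with the diagonal, which is the fixed space of [s]. *)
Lemma dokchitser_regular_quotient (Q : int -> int -> Prop) (h c d c' : int) :
  (forall a b, lift_image w q (e *~ a + f *~ b) <-> Q a b) ->
  h != 0 -> d != 0 -> c' != 0 -> Q h 0 -> Q c d ->
  (forall a b, Q a b -> exists t u, a = h * t + c * u /\ b = d * u) ->
  (forall a, Q a a <-> (c' %| a)%Z) ->
  C M = k * c'%:~R ^+ 4 / (h * d)%:~R ^+ 2.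
Proof.
move=> PQ h0 d0 c0 Qh Qcd Qsp Qdiag.
pose eY : 'I_(1 + 1) -> Y := famcat (fun=> e) (fun=> f).
pose D : 'M[int]_(1 + 1) := block_mx h%:M 0 c%:M d%:M.
have single (v : Y) l : lincomb (fun _ : 'I_1 => v) (row 0 l%:M) = v *~ l.
  by rewrite /lincomb big_ord1 !mxE eqxx.
have DE : famcat (fun _ : 'I_1 => e *~ h) (fun _ : 'I_1 => e *~ c + f *~ d) =1
    fammul D eY.
  move=> j; rewrite -(splitK j) /fammul /D; case: (split j) => l /=; rewrite [l]ord1.
    by rewrite famcat_l /block_mx rowKu row_row_mx lincomb_cat row0 lincomb0 addr0 single.
  by rewrite famcat_r /block_mx rowKd row_row_mx lincomb_cat !single.
have beY : zfree_basis setT eY by apply: zfree_pair.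
have efE l : (e + f) *~ l = e *~ l + f *~ l by rewrite mulrzDl.
have fixE (v : Y) : zg_act s v = v -> exists l, v = (e + f) *~ l.
  have [a [b ->]] := sp v; rewrite regular_s => /regular_inj[-> _].
  by exists a; rewrite efE.
have sef l : zg_act s ((e + f) *~ l) = (e + f) *~ l by rewrite efE regular_s.
have freef l : (e + f) *~ l = 0 -> l = 0 by rewrite efE => /fr[].
have beS : zfree_basis [set y | zg_act s y = y]%classic (fun _ : 'I_1 => e + f).
  by apply: zfree_single => //=; have := sef 1; rewrite mulr1z.
have bD : zfree_basis (lift_image w q) (fammul D eY).
  apply: eq_zfree (_ : zfree_basis (lift_image w q)
    (famcat (fun _ : 'I_1 => e *~ h) (fun _ : 'I_1 => e *~ c + f *~ d))) => //.
  have E t u : e *~ h *~ t + (e *~ c + f *~ d) *~ u =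
      e *~ (h * t + c * u) + f *~ (d * u).
    by rewrite mulrzDl addrA -!mulrzA -mulrzDr.
  apply: zfree_pair => [||v|t u].
  - by rewrite -[e *~ h]addr0 -(mulr0z f); apply/PQ.
  - exact/PQ.
  - have [a [b ->]] := sp v; move=> /PQ/Qsp[t [u [-> ->]]].
    by exists t, u; rewrite E.
  - rewrite E => /fr[tu /eqP]; rewrite mulf_eq0 (negPf d0) => /eqP u0.
    move/eqP: tu; rewrite u0 mulr0 addr0 mulf_eq0 (negPf h0) => /eqP ->.
    by [].
have bD' : zfree_basis [set y | lift_image w q y /\ zg_act s y = y]%classic
    (fammul c'%:M (fun _ : 'I_1 => e + f)).
  apply: eq_zfree (_ : zfree_basis
    [set y | lift_image w q y /\ zg_act s y = y]%classic
    (fun _ : 'I_1 => (e + f) *~ c')) => //.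
    by move=> j; rewrite /fammul /lincomb big_ord1 !mxE !ord1 eqxx.
  apply: zfree_single => [|v [Pv /fixE[l vl]]|l].
  - by split; [rewrite efE; apply/PQ/Qdiag | exact: sef].
  - move: Pv; rewrite vl efE => /PQ/Qdiag/dvdzP[j ->].
    by exists j; rewrite -efE mulrC mulrzA.
  - by rewrite -mulrzA => /freef/eqP; rewrite mulf_eq0 (negPf c0) => /eqP.
rewrite (dokchitser_exact p_pr p_odd dih Xk Yw iq beY beS bD bD').
rewrite det_lblock !det_scalar !expr1 muln1 mulfK //.
by rewrite expf_neq0 // p_rat_neq0.
Qed.

(** By [lift_sign], [e + sg f] lifts; non-splitness says that [e] does not. *)
Lemma regular_lift (sg : int) : sg = 1 \/ sg = -1 ->
  (forall x : X, exists x', zg_act s x - x *~ sg = zg_act w x' - x') ->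
  ~ splits q ->
  forall a b, lift_image w q (e *~ a + f *~ b) <-> (p %| a - sg * b)%Z.
Proof.
move=> sg1 Xsg ns a b; have [_ qh _ qs _] := iq; have [qB qa] := qh.
have Pg := lift_image_zsubgroup w qh.
have Pp y : lift_image w q (y *+ p) := lift_image_p p_pr dih qh qs Yw y.
have sgK : sg * sg = 1 by case: sg1 => ->.
have Pef : lift_image w q (e + f *~ sg).
  have [m qm] := qs e; have -> : e + f *~ sg = q (m + zg_act s m *~ sg).
    by rewrite (zmapD qB) (zmapMz qB) qa qm se.
  apply: (lift_sign p_pr p_odd dih Xk Yw iq sg1 Xsg).
  rewrite (zmapD (zg_actB s)) (zmapMz (zg_actB s)) (act_ss dih) mulrzDl.
  by rewrite -mulrzA sgK mulr1z addrC.
have E : e *~ a + f *~ b = (e + f *~ sg) *~ (sg * b) + e *~ (a - sg * b).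
  rewrite mulrzDl -mulrzA mulrA sgK mul1r mulrzBr.
  by rewrite addrAC [_ + (_ - _)]addrC subrK.
rewrite E; split=> [P|/dvdzP[j ->]]; last first.
  rewrite [e *~ (j * _)]mulrzA.
  exact: (zsubgroupD Pg (zsubgroupMz _ Pg Pef) (Pp (e *~ j))).
have Pe : lift_image w q (e *~ (a - sg * b)).
  rewrite -[X in lift_image w q X](addKr ((e + f *~ sg) *~ (sg * b))) addrC.
  by apply: Pg.2 => //; apply: zsubgroupMz.
apply: contrapT => /negP pl; have [y] := nonsplit_lift Xk iq ns; case.
have Pe1 := zsubgroup_bezout p_pr Pg (Pp e) Pe pl.
have [a' [b' ->]] := sp y; apply: zsubgroupD => //; apply: zsubgroupMz => //.
by rewrite -se; apply: (lift_image_s p_pr dih qh).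
Qed.
End Regular.
End Quotients.

Section RegularPermutation.
Variables (p : nat) (gT : finGroupType) (s w : gT).
Hypotheses (p_pr : prime p) (dih : dihedral_gens p s w).
Local Notation Delta := (zg_perm <[w]>%G).

Lemma zg_perm_regular : exists e f : Delta,
  [/\ forall y : Delta, zg_act w y = y, zg_act s e = f,
      forall y, exists a b, y = e *~ a + f *~ b
    & forall a b, e *~ a + f *~ b = 0 -> a = 0 /\ b = 0].
Proof.
have sV : (s^-1 = s)%g.
  by apply/eqP; rewrite eq_invg_mul -expg2 (dih_s dih).
have ws : (w^-1 * s = s * w)%g by have := dih_conj dih 1; rewrite !expg1 => ->.
have cosP x : (x *: <[w]>)%g \in lcosets <[w]>%g [set: gT]%g.
  by apply/lcosetsP; exists x; rewrite ?inE.
pose c0 : coset_space <[w]>%G :=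
  Sub (1 *: <[w]>)%g (cosP 1%g).
pose c1 : coset_space <[w]>%G :=
  Sub (s *: <[w]>)%g (cosP s).
have ww : (w *: <[w]> = <[w]>)%g by apply: lcoset_id; apply: cycle_id.
have wVw : (w^-1 *: <[w]> = <[w]>)%g.
  by apply: lcoset_id; rewrite groupV cycle_id.
have cP c : c = c0 \/ c = c1.
  have [x _ cx] := lcosetsP (valP c).
  have [[k b] xE _] : exists2 kb, x = dih_word s w (kb : 'I_p * bool) & true.
    by have [g _ gK] := dih_word_bij p_pr dih; exists (g x).
  rewrite /dih_word /= in xE; case: b xE => xE; [right | left]; apply: val_inj => /=.
    rewrite cx xE expg1 -{1}(lcoset_id (mem_cycle w k)) -lcosetM -mulgA.
    by rewrite (dih_conj dih) mulKVg.
  by rewrite cx xE expg0 mulg1 lcoset1; apply: lcoset_id; apply: mem_cycle.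
have c01 : c1 != c0.
  apply/eqP => /(congr1 val) /= c10; have := lcoset_refl <[w]>%G s.
  by rewrite c10 lcoset1 (negPf (dih_notin p_pr dih)).
have tw (c : coset_space <[w]>%G) : coset_translate w^-1%g c = c.
  apply: val_inj => /=; case: (cP c) => -> /=; first by rewrite lcoset1 wVw.
  by rewrite -lcosetM ws lcosetM ww.
have ts0 : coset_translate s^-1%g c0 = c1.
  by apply: val_inj; rewrite /= sV lcoset1.
have ts1 : coset_translate s^-1%g c1 = c0.
  by apply: val_inj; rewrite /= -lcosetM mulVg.
pose e : Delta := [ffun c => (c == c0)%:R].
pose f : Delta := [ffun c => (c == c1)%:R].
have eE (c : coset_space <[w]>%G) : e c = (c == c0)%:R by rewrite ffunE.
have fE (c : coset_space <[w]>%G) : f c = (c == c1)%:R by rewrite ffunE.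
have evB (c : coset_space <[w]>%G) (x y : Delta) : (x - y) c = x c - y c.
  by rewrite !ffunE.
have ev (c : coset_space <[w]>%G) a b :
    (e *~ a + f *~ b) c = (c == c0)%:R *~ a + (c == c1)%:R *~ b.
  by rewrite (zmapD (evB c)) !(zmapMz (evB c)) eE fE.
exists e, f; split.
- by move=> y; apply/ffunP => c; rewrite ffunE tw.
- apply/ffunP => c; rewrite ffunE eE fE; case: (cP c) => ->.
    by rewrite ts0 (negPf c01) eq_sym (negPf c01).
  by rewrite ts1 !eqxx.
- move=> y; exists (y c0), (y c1); apply/ffunP => c; rewrite ev.
  case: (cP c) => ->; rewrite ?eqxx ?(negPf c01) 1?eq_sym ?(negPf c01).
    by rewrite mul0rz addr0 intz.
  by rewrite mul0rz add0r intz.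
move=> a b ab0; split.
  have := ev c0 a b; rewrite ab0 ffunE eqxx eq_sym (negPf c01) mul0rz addr0 intz.
  by move=> <-.
have := ev c1 a b; rewrite ab0 ffunE eqxx (negPf c01) mul0rz add0r intz.
by move=> <-.
Qed.
End RegularPermutation.

Theorem theorem4p4 (p : nat) (p_pr : prime p) (p_odd : odd p)
    (gT : finGroupType) (s w : gT) (dih : dihedral_gens p s w)
    (z : algC) (z_prim : p.-primitive_root z)
    (I : Type) (U : I -> real_ideal z) (U_cl : represents_class_group U) :
  let C (M : zgmodule gT) : rat := dokchitser M (Theta_dihedral s w) in
  let one := zg_trivial gT in
  let eps := zg_sign p_pr dih in
  let Delta := zg_perm <[w]>%G in
  let A i := zg_A p_pr dih z_prim (U i) in
  let A' i := zg_A' p_pr dih z_prim (U i) in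
  C one = p%:R^-1 /\
  C eps = p%:R /\
  C Delta = 1 /\
  forall i : I,
    C (A i) = p%:R /\
    C (A' i) = p%:R^-1 /\
    (forall M, nontrivial_extension (A' i) one M -> C M = 1) /\
    (forall M, nontrivial_extension (A i) eps M -> C M = 1) /\
    (forall M, nontrivial_extension (A i) Delta M -> C M = p%:R^-1) /\
    (forall M, nontrivial_extension (A' i) Delta M -> C M = p%:R) /\
    (forall M, bi_nontrivial_extension (A i) (A' i) Delta M -> C M = 1).
Proof.
move=> C one eps Delta A A'.
have p0 := p_rat_neq0 p_pr; have pz0 := p_neq0 p_pr.
have p2 (a : int) : (p %| 2 * a)%Z = (p %| a)%Z.
  rewrite Gauss_dvdzr // coprimezE /= prime_coprime // dvdn_prime2 //.
  by apply: contraTneq p_odd => ->.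
have idlift (Y : zgmodule gT) (y : Y) : (forall y : Y, zg_act w y = y) ->
  lift_image w (fun y : Y => y) y by move=> Yw; exists y.
have one_w (y : one) : zg_act w y = y by [].
have one_s : zg_act s (1 : one) = 1 by [].
have eps_w (y : eps) : zg_act w y = y by exact: dih_module_w.
have eps_s : zg_act s (1 : eps) = -1 by exact: dih_module_s.
have int_sp (y : int) : exists k, y = 1 *~ k by exists y; rewrite intz.
have int_fr (k : int) : 1 *~ k = 0 :> int -> k = 0 by rewrite intz.
have [e [f [D_w D_s D_sp D_fr]]] := zg_perm_regular p_pr dih.
split.
  have [X [i [Xk iq]]] := zero_exact s w one.
  rewrite /C (dokchitser_trivial_quotient p_pr p_odd dih one_w int_sp int_fr Xk iq
    one_s (n := 1)) ?expr1n ?mul1r // => l.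
  by rewrite dvd1z; split=> // _; apply: idlift.
split.
  have [X [i [Xk iq]]] := zero_exact s w eps.
  rewrite /C (dokchitser_sign_quotient p_pr p_odd dih eps_w int_sp int_fr Xk iq
    eps_s (n := 1)) ?expr1n ?divr1 ?mul1r // => l.
  by rewrite dvd1z; split=> // _; apply: idlift.
split.
  have [X [i [Xk iq]]] := zero_exact s w Delta.
  rewrite /C (dokchitser_regular_quotient p_pr p_odd dih D_w D_s D_sp D_fr Xk iq
    (Q := fun _ _ => True) (h := 1) (c := 0) (d := 1) (c' := 1)) //.
  - by move=> a b; split=> // _; apply: idlift.
  - by move=> a b _; exists a, b; rewrite mul0r addr0 !mul1r.
(* the extensions of the quotients above by [A], [A'] and their sum *)
move=> i.
have kA := cyclotomic_zg_A p_pr p_odd dih z_prim (U i).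
have kA' := cyclotomic_zg_A' p_pr p_odd dih z_prim (U i).
have kS := cyclotomic_zg_sum p_pr p_odd dih z_prim (U i).
have [v vE] := zg_A_embedding p_pr dih z_prim (U i).
have [v' vE'] := zg_A'_embedding p_pr p_odd dih z_prim (U i).
have sgA := embedding_sign p_pr z_prim vE.
have sgA' := embedding_sign p_pr z_prim vE'.
split; first exact: (dokchitser_cyclotomic p_pr p_odd dih kA).
split; first exact: (dokchitser_cyclotomic p_pr p_odd dih kA').
split.
  move=> M [j [q [jq ns]]].
  rewrite /C (dokchitser_trivial_quotient p_pr p_odd dih one_w int_sp int_fr kA' jq
    one_s pz0 (rank_one_lift p_pr dih one_w int_sp kA' jq ns)).
  by field.
split.
  move=> M [j [q [jq ns]]].
  rewrite /C (dokchitser_sign_quotient p_pr p_odd dih eps_w int_sp int_fr kA jq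
    eps_s pz0 (rank_one_lift p_pr dih eps_w int_sp kA jq ns)).
  by field.
have liftA (M : zgmodule gT) (j : A i -> M) (q : M -> Delta) :
    short_exact j q -> ~ splits q ->
    forall a b, lift_image w q (e *~ a + f *~ b) <-> (p %| a - b)%Z.
  move=> jq ns a b; rewrite -[b in (_ - b)%R]mul1r.
  by apply: (regular_lift p_pr p_odd dih D_w D_s D_sp kA jq _ sgA ns); left.
have liftA' (M : zgmodule gT) (j : A' i -> M) (q : M -> Delta) :
    short_exact j q -> ~ splits q ->
    forall a b, lift_image w q (e *~ a + f *~ b) <-> (p %| a + b)%Z.
  move=> jq ns a b; have -> : a + b = a - (-1) * b by rewrite mulN1r opprK.
  by apply: (regular_lift p_pr p_odd dih D_w D_s D_sp kA' jq _ sgA' ns); right.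
split.
  move=> M [j [q [jq ns]]].
  rewrite /C (dokchitser_regular_quotient p_pr p_odd dih D_w D_s D_sp D_fr kA jq
    (h := p) (c := 1) (d := 1) (c' := 1) (liftA _ _ _ jq ns)) //.
  - by rewrite mulr1; field.
  - by rewrite subr0.
  - move=> a b /dvdzP[t ab]; exists t, b; rewrite !mul1r mulrC -ab.
    by rewrite subrK.
  - by move=> a; rewrite subrr dvdz0 dvd1z.
split.
  move=> M [j [q [jq ns]]].
  rewrite /C (dokchitser_regular_quotient p_pr p_odd dih D_w D_s D_sp D_fr kA' jq
    (h := p) (c := -1) (d := 1) (c' := p) (liftA' _ _ _ jq ns)) //.
  - by rewrite mulr1; field.
  - by rewrite addr0.
  - move=> a b /dvdzP[t ab]; exists t, b; rewrite mulN1r mul1r mulrC -ab.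
    by rewrite addrK.
  - by move=> a; rewrite -mulr2n -mulr_natl p2.
move=> M [j [q [jq push push']]].
(* what lifts to [M] lifts to both pushforwards, which are non-split extensions by
   [A] and by [A'] *)
have image_push (M' : zgmodule gT) (q' : M' -> Delta) (g : M -> M') y :
    zg_hom g -> (forall m, q' (g m) = q m) -> lift_image w q y -> lift_image w q' y.
  by move=> [_ ga] qg [m wm <-]; exists (g m); rewrite // -ga wm.
have [M1 [j1 [q1 [g1 [jq1 hg1 _ qg1 ns1]]]]] := push.
have [M2 [j2 [q2 [g2 [jq2 hg2 _ qg2 ns2]]]]] := push'.
have liftS a b : lift_image w q (e *~ a + f *~ b) <-> (p %| a)%Z /\ (p %| b)%Z.
  split=> [Pab|[/dvdzP[a' ->] /dvdzP[b' ->]]].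
    have /(liftA _ _ _ jq1 ns1) amb := image_push _ q1 g1 _ hg1 qg1 Pab.
    have /(liftA' _ _ _ jq2 ns2) apb := image_push _ q2 g2 _ hg2 qg2 Pab.
    have pa : (p %| a)%Z.
      rewrite -p2; have -> : 2 * a = (a - b) + (a + b) by ring.
      exact: rpredD.
    split=> //; have -> : b = (a + b) - a by rewrite addrC addKr.
    exact: rpredB.
  have [_ qh _ qs _] := jq.
  apply: (zsubgroupD (lift_image_zsubgroup w qh)); rewrite mulrzA.
    exact: (lift_image_p p_pr dih qh qs D_w (e *~ a')).
  exact: (lift_image_p p_pr dih qh qs D_w (f *~ b')).
rewrite /C (dokchitser_regular_quotient p_pr p_odd dih D_w D_s D_sp D_fr kS jq
  (h := p) (c := 0) (d := p) (c' := p) liftS) //.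
- by rewrite intrM; field.
- move=> a b [/dvdzP[t ->] /dvdzP[u ->]]; exists t, u.
  by rewrite mul0r addr0; split; apply: mulrC.
- by move=> a; split=> [[]|pa].
Qed.
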